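(* For $|x|<1/2$, $|y|<1/2$ and $|x+y|<1/2$, $$\sum_{m,n=1}^\infty R(m+1,\underbrace{1,\ldots,1}_{n-1})\,x^my^n=\frac{\Gamma(1/2)\Gamma(1-y)}{\Gamma(1/2-y)}-\frac{\Gamma(1/2-x)\Gamma(1-y)}{\Gamma(1/2-x-y)}.$$
   Context: For positive integers $k_1,\dots,k_r$ with $k_1>1$, the multiple $R$-value is $$R(k_1,k_2,\ldots,k_r)=2^{k_1+\cdots+k_r}\sum_{n_1>\cdots>n_r>0}\frac{1}{(2n_1-1)^{k_1}(2n_2)^{k_2}\cdots(2n_r)^{k_r}},$$ so that for $r=1$, $R(k)=2^k\sum_{n\ge1}\frac{1}{(2n-1)^k}$. *)

(* Defs.v *)
From HB Require Import structures.
From mathcomp Require Import all_boot all_order all_algebra.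
From mathcomp Require Import all_classical all_reals all_analysis.
From mathcomp Require Import summability.
Set Implicit Arguments.
Unset Strict Implicit.
Unset Printing Implicit Defensive.
Import Order.TTheory GRing.Theory Num.Theory.
Import numFieldNormedType.Exports.
From mathcomp Require Import complex.
Local Open Scope classical_set_scope.
Local Open Scope ring_scope.
Local Open Scope complex_scope.

(* The index set n_1 > ... > n_r > 0, as sequences n = [:: n_1; ...; n_r]. *)
Definition Rvalue_index (r : nat) : set (seq nat) :=
  [set n | size n = r /\ sorted gtn (rcons n 0%N)].

(* Positions are counted from 0, so k_1 and n_1 are nth 0 k 0 and nth 0 n 0. *)
Definition Rvalue_term (R : realType) (k n : seq nat) : R :=
  ((2 * (nth 0%N n 0)%:R - 1) ^+ nth 0%N k 0
   * \prod_(1 <= i < size k) (2 * (nth 0%N n i)%:R) ^+ nth 0%N k i)^-1.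

(* R(k_1, ..., k_r) for k = [:: k_1; ...; k_r].  The terms are nonnegative, so
   the multiple series is a supremum of finite sums in \bar R; it is finite
   when k_1 > 1 and k_2, ..., k_r > 0. *)
Definition Rvalue (R : realType) (k : seq nat) : R :=
  2 ^+ sumn k
  * fine (\esum_(n in Rvalue_index (size k)) (Rvalue_term R k n)%:E).

Definition cexp (R : realType) (z : R[i]) : R[i] :=
  (expR (Re z))%:C * (cos (Im z) +i* sin (Im z)).

(* The principal power t ^ z of a real t > 0. *)
Definition cpow (R : realType) (t : R) (z : R[i]) : R[i] :=
  cexp (z * (ln t)%:C).

(* Euler's integral: this is the Gamma function on the half-plane Re z > 0
   only (no analytic continuation; outside of it the value is arbitrary). *)
Definition cGamma (R : realType) (z : R[i]) : R[i] :=
  let f (t : R) := cpow t (z - 1) * cexp (- t%:C) in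
  (\int[@lebesgue_measure R]_(t in `]0%R, +oo[) Re (f t))
  +i* (\int[@lebesgue_measure R]_(t in `]0%R, +oo[) Im (f t)).

(* Main.v *)
Require Import Defs.
From HB Require Import structures.
From mathcomp Require Import all_boot all_order all_algebra.
From mathcomp Require Import finmap.
From mathcomp Require Import all_classical all_reals all_analysis.
From mathcomp Require Import summability measurable_realfun.
Import Order.TTheory GRing.Theory Num.Theory.
Import numFieldNormedType.Exports.
From mathcomp Require Import complex.
From mathcomp Require Import ring lra.

(** The terms of the double series are grouped by their largest index
    n_1 = N + 1.  For a fixed N the geometric series in x and the generating function
      sum_n e_n(1, 1/2, ..., 1/N) y^n = prod_(j <= N) (1 + y/j) = (1 + y)_N / N!
    (harmonic_gen) turn the terms with n_1 = N + 1 into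
      x y (1 + y)_N / (N! (N + 1/2) (N + 1/2 - x))
    (gamma_term), and the absolute values of these terms, summed in the same
    way, are bounded by a constant times (1 + |y|)_N / (N! (N + 1) (N + 2)), which
    telescopes.  The rearrangement is therefore legitimate
    (uncond_cvg_series), and it remains to evaluate the simple series over N.

    With G(s) = Gamma(s) Gamma(1 - y) / Gamma(s - y), the claim is that this
    series equals G(1/2) - G(1/2 - x).  Formally, G(s) = -sum_k y c_k / (k + s)
    with c_k = (1 + y)_k / k!, by expanding (1 - t)^(-y-1) in Euler's Beta integral,
    but that integral diverges when Re y >= 0.  The convergent expansion is
      Gamma(s) Gamma(1 - y) = Gamma(s + 1 - y) sum_k a_k / (k + s),  a_k = (y)_k / k!
    (gamma_series_cvg).  Since (s - y) a_k / (k + s) = a_k - y c_k / (k + s), the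
    terms of the two expansions differ by a_k, which does not depend on s and
    cancels in G(1/2) - G(1/2 - x) (gamma_difference_series).

    The series for Gamma(s) Gamma(1 - y) is obtained without a Beta function:
    in the double integral of t^(s-1) u^(-y) e^(-t-u), the factor u^(-y) is expanded
    in powers of r = t / (t + u) by the binomial series
      u^(-y) = (t + u)^(-y) (1 - r)^(-y) = sum_k a_k (t + u)^(-y-k) t^k,
    each term is integrated after the translation w = t + u and an exchange of
    the integrals over the wedge t < w (cint_wedge_shear), and dominated
    convergence gives the sum.  Its case y = 0 is the functional equation of
    Gamma.

    Dividing by Gamma(s - y) requires that Gamma has no zero with positive real
    part.  By the functional equation a zero z would make Gamma vanish at all
    z + n; but for real part p large compared with the square of the imaginary
    part q, the integrand of Gamma(z) p^(-iq) concentrates around t = p, where its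
    phase q ln(t / p) is small, so that the real part is positive
    (cGamma_neq0_large). *)

Set Implicit Arguments.
Unset Strict Implicit.
Unset Printing Implicit Defensive.
Local Open Scope classical_set_scope.
Local Open Scope ring_scope.
Local Open Scope complex_scope.

Local Notation normc := ComplexField.Normc.normc.

(** * Complex modulus and complex powers of positive reals *)

Section complex_modulus.
Variable R : realType.
Implicit Types (z w c : R[i]) (t u : R).

Lemma ReM z w : Re (z * w) = Re z * Re w - Im z * Im w.
Proof. by case: z w => a b [c d]. Qed.

Lemma ImM z w : Im (z * w) = Re z * Im w + Im z * Re w.
Proof. by case: z w => a b [c d]. Qed.

Lemma ReMr z t : Re (z * t%:C) = Re z * t.
Proof. by rewrite ReM /= mulr0 subr0. Qed.

Lemma ImMr z t : Im (z * t%:C) = Im z * t.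
Proof. by rewrite ImM /= mulr0 add0r. Qed.

Lemma ReD z w : Re (z + w) = Re z + Re w.
Proof. by case: z w => a b [c d]. Qed.

Lemma ImD z w : Im (z + w) = Im z + Im w.
Proof. by case: z w => a b [c d]. Qed.

Lemma ReN z : Re (- z) = - Re z. Proof. by case: z. Qed.

Lemma ImN z : Im (- z) = - Im z. Proof. by case: z. Qed.

Lemma Re_sum I (r : seq I) (P : pred I) (F : I -> R[i]) :
  Re (\sum_(i <- r | P i) F i) = \sum_(i <- r | P i) Re (F i).
Proof. by apply: (big_morph _ ReD). Qed.

Lemma Im_sum I (r : seq I) (P : pred I) (F : I -> R[i]) :
  Im (\sum_(i <- r | P i) F i) = \sum_(i <- r | P i) Im (F i).
Proof. by apply: (big_morph _ ImD). Qed.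

Lemma complex_eq z w : Re z = Re w -> Im z = Im w -> z = w.
Proof. by case: z w => a b [c d] /= -> ->. Qed.

Lemma normc_ge0 z : 0 <= normc z.
Proof. by rewrite -ler0c; exact: (normr_ge0 z). Qed.

Lemma normcD z w : normc (z + w) <= normc z + normc w.
Proof. by rewrite -lecR rmorphD; exact: (ler_normD z w). Qed.

Lemma normcB z w : normc (z - w) <= normc z + normc w.
Proof. by rewrite -lecR rmorphD; exact: (ler_normB z w). Qed.

Lemma normcR t : normc t%:C = `|t|.
Proof. by rewrite /= expr0n addr0 sqrtr_sqr. Qed.

Lemma normc_nat n : normc (n%:R : R[i]) = n%:R.
Proof. by rewrite -(rmorph_nat (real_complex R)) normcR normr_nat. Qed.

Lemma normcM z w : normc (z * w) = normc z * normc w.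
Proof. exact: ComplexField.Normc.normcM. Qed.

Lemma normc_opp z : normc (- z) = normc z.
Proof. by case: z => a b /=; rewrite !sqrrN. Qed.

Lemma normcX z n : normc (z ^+ n) = normc z ^+ n.
Proof.
elim: n => [|n IH]; first by rewrite !expr0 ComplexField.Normc.normc1.
by rewrite !exprS normcM IH.
Qed.

Lemma normcV z : normc z^-1 = (normc z)^-1.
Proof. exact: ComplexField.Normc.normcV. Qed.

Lemma normc_sum I (r : seq I) (P : pred I) (F : I -> R[i]) :
  normc (\sum_(i <- r | P i) F i) <= \sum_(i <- r | P i) normc (F i).
Proof.
elim/big_ind2 : _ => //; first by rewrite ComplexField.Normc.normc0.
by move=> x y z w hx hy; rewrite (le_trans (normcD _ _))// lerD.
Qed.

Lemma normc_Re z : `|Re z| <= normc z.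
Proof.
case: z => a b /=; rewrite -[leLHS]ger0_norm// -sqrtr_sqr ler_wsqrtr//.
by rewrite -normrX ger0_norm ?sqr_ge0// lerDl sqr_ge0.
Qed.

Lemma normc_Im z : `|Im z| <= normc z.
Proof.
case: z => a b /=; rewrite -[leLHS]ger0_norm// -sqrtr_sqr ler_wsqrtr//.
by rewrite -normrX ger0_norm ?sqr_ge0// lerDr sqr_ge0.
Qed.

Lemma normc_le_ReIm z : normc z <= `|Re z| + `|Im z|.
Proof.
case: z => a b.
have -> : a +i* b = a%:C + (0 +i* b) by apply: complex_eq; rewrite /= ?addr0 ?add0r.
apply: le_trans (normcD _ _) _; rewrite /= !add0r addr0.
by rewrite expr0n/= add0r addr0 !sqrtr_sqr.
Qed.

End complex_modulus.

Section complex_powers.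
Variable R : realType.
Implicit Types (z w a c : R[i]) (t u : R).

Lemma cexpD z w : cexp (z + w) = cexp z * cexp w.
Proof.
rewrite /cexp ReD ImD expRD cosD sinD.
by apply: complex_eq; rewrite !(ReM, ImM) /=; ring.
Qed.

Lemma cexp0 : cexp (0 : R[i]) = 1.
Proof. by rewrite /cexp /= expR0 cos0 sin0 mul1r. Qed.

Lemma cexpR t : cexp t%:C = (expR t)%:C.
Proof. by rewrite /cexp /= cos0 sin0 mulr1. Qed.

Lemma normc_cexp z : normc (cexp z) = expR (Re z).
Proof.
rewrite /cexp normcM normcR ger0_norm ?expR_ge0//= cos2Dsin2 sqrtr1.
by rewrite mulr1.
Qed.

Lemma cpowD t z w : cpow t (z + w) = cpow t z * cpow t w.
Proof. by rewrite /cpow mulrDl cexpD. Qed.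

Lemma cpow0 t : cpow t 0 = 1 :> R[i].
Proof. by rewrite /cpow mul0r cexp0. Qed.

Lemma cpowNK t z : cpow t (- z) * cpow t z = 1.
Proof. by rewrite -cpowD addNr cpow0. Qed.

Lemma cpow1 z : cpow 1 z = 1.
Proof. by rewrite /cpow ln1 rmorph0 mulr0 cexp0. Qed.

Lemma cpow_id t : 0 < t -> cpow t 1 = t%:C.
Proof. by move=> t0; rewrite /cpow mul1r cexpR lnK. Qed.

Lemma cpowM t u z : 0 < t -> 0 < u -> cpow (t * u) z = cpow t z * cpow u z.
Proof. by move=> t0 u0; rewrite /cpow lnM// rmorphD mulrDr cexpD. Qed.

Lemma cpowX t n : 0 < t -> cpow t n%:R = t%:C ^+ n.
Proof.
move=> t0; elim: n => [|n IH]; first by rewrite cpow0 expr0.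
by rewrite -addn1 natrD cpowD cpow_id// IH addn1 exprSr.
Qed.

Lemma normc_cpow t z : 0 < t -> normc (cpow t z) = t `^ Re z.
Proof. by move=> t0; rewrite /cpow normc_cexp ReMr /powR gt_eqF. Qed.

Lemma cpowR t u : 0 < t -> cpow t u%:C = (t `^ u)%:C.
Proof. by move=> t0; rewrite /cpow -rmorphM cexpR /powR gt_eqF. Qed.

Lemma Re_cexp_line c a t : Re (c * cexp (a * t%:C)) =
  expR (Re a * t) * (Re c * cos (Im a * t) - Im c * sin (Im a * t)).
Proof. by rewrite /cexp ReMr ImMr !(ReM, ImM) /=; ring. Qed.

Lemma is_derive_Re_cexp c a t :
  is_derive t 1 (fun s => Re (c * cexp (a * s%:C))) (Re (c * a * cexp (a * t%:C))).
Proof.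
have -> : (fun s => Re (c * cexp (a * s%:C))) = (fun s => expR (Re a * s) *
  (Re c * cos (Im a * s) - Im c * sin (Im a * s))).
  by apply/funext => s; exact: Re_cexp_line.
rewrite Re_cexp_line.
have h b : is_derive t 1 (fun s : R => b * s) b.
  by apply: is_derive_eq; rewrite -[RHS]mulr1.
have he := @is_derive1_comp _ expR (fun s => Re a * s) t _ _ (is_derive_expR _) (h _).
have hc := @is_derive1_comp _ cos (fun s => Im a * s) t _ _ (is_derive_cos _) (h _).
have hs := @is_derive1_comp _ sin (fun s => Im a * s) t _ _ (is_derive_sin _) (h _).
have h1 : is_derive t 1 (fun s => Re c * cos (Im a * s) - Im c * sin (Im a * s))
  (Re c * (- sin (Im a * t) * Im a) - Im c * (cos (Im a * t) * Im a)).
  exact: (is_deriveB (is_deriveZ (Re c) hc) (is_deriveZ (Im c) hs)).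
apply: (is_derive_eq (is_deriveM he h1)).
by rewrite !(ReM, ImM) /= /GRing.scale /=; ring.
Qed.

Lemma is_derive_Re_cpow c a t : 0 < t ->
  is_derive t 1 (fun s => Re (c * cpow s a)) (Re (c * a * cpow t (a - 1))).
Proof.
move=> t0.
have h := @is_derive1_comp _ (fun s => Re (c * cexp (a * s%:C))) (@ln R) t _ _
  (is_derive_Re_cexp _ _ _) (is_derive1_ln t0).
apply: (is_derive_eq h).
rewrite -ReMr cpowD -mulrA; congr (Re (_ * (_ * _))).
rewrite /cpow mulN1r -rmorphN cexpR expRN lnK//.
Qed.

Lemma continuous_Re_cpow c a t : 0 < t ->
  {for t, continuous (fun s => Re (c * cpow s a))}.
Proof.
by move=> t0; apply/differentiable_continuous/derivable1_diffP;
  case: (is_derive_Re_cpow c a t0).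
Qed.

End complex_powers.

(** * The binomial series *)

(** The quotient (y)_k / k!, that is, the k-th coefficient of (1 - r)^(-y). *)
Definition rising_ratio (F : fieldType) (y : F) (k : nat) : F :=
  \prod_(j < k) ((y + j%:R) / j.+1%:R).

Section rising_ratio_theory.
Variable R : realType.
Implicit Types (y c : R[i]) (b r : R) (k : nat).

Lemma rising_ratio0 (F : fieldType) (y : F) : rising_ratio y 0 = 1.
Proof. by rewrite /rising_ratio big_ord0. Qed.

Lemma rising_ratioS (F : fieldType) (y : F) k :
  rising_ratio y k.+1 = rising_ratio y k * ((y + k%:R) / k.+1%:R).
Proof. by rewrite /rising_ratio big_ord_recr. Qed.

Lemma rising_ratio_ge0 b k : 0 <= b -> 0 <= rising_ratio b k.
Proof.
by move=> b0; apply: prodr_ge0 => j _; rewrite divr_ge0// addr_ge0.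
Qed.

Lemma rising_ratio_le1 b k : 0 <= b <= 1 -> rising_ratio b k <= 1.
Proof.
move=> /andP[b0 b1]; apply: prodr_ile1 => j _; rewrite divr_ge0 ?addr_ge0//=.
by rewrite ler_pdivrMr// mul1r -natr1 addrC lerD2l.
Qed.

Lemma normc_rising_ratio y k : normc (rising_ratio y k) <= rising_ratio (normc y) k.
Proof.
elim: k => [|k IH]; first by rewrite !rising_ratio0 ComplexField.Normc.normc1.
rewrite !rising_ratioS !normcM normcV ler_pM ?mulr_ge0 ?invr_ge0 ?normc_ge0//.
by rewrite !normc_nat ler_wpM2r ?invr_ge0// (le_trans (normcD _ _))// normc_nat.
Qed.

Lemma rising_ratioR b k : rising_ratio b%:C k = (rising_ratio b k)%:C.
Proof.
rewrite /rising_ratio rmorph_prod; apply: eq_bigr => j _.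
by rewrite rmorphM fmorphV rmorphD !rmorph_nat.
Qed.

Definition binomial_sum (y : R[i]) (n : nat) (r : R) : R[i] :=
  \sum_(k < n) rising_ratio y k * (r ^+ k)%:C.

(** All terms of the derivative of (1 - r)^y S_n(r) but the last cancel, because
    (k + 1) a_(k+1) = (k + y) a_k.  This closed form gives both the limit of S_n and
    the bound on S_n uniform in n, with no termwise differentiation.  The factor
    c selects the real or the imaginary part of a complex-valued function. *)
Lemma is_derive_binomial_sum y c n r : r < 1 ->
  is_derive r 1 (fun s => Re (c * (cpow (1 - s) y * binomial_sum y n s)))
    (- (r ^+ n.-1 * n%:R * Re (c * (cpow (1 - r) (y - 1) * rising_ratio y n)))).
Proof.
move=> r1; elim: n => [|n IH].
  have -> : (fun s => Re (c * (cpow (1 - s) y * binomial_sum y 0 s))) = cst 0.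
    by apply/funext => s; rewrite /binomial_sum big_ord0 !mulr0.
  by rewrite mulr0 mul0r oppr0; exact: is_derive_cst.
have -> : (fun s => Re (c * (cpow (1 - s) y * binomial_sum y n.+1 s))) =
  (fun s => Re (c * (cpow (1 - s) y * binomial_sum y n s))) +
  (fun s => (fun s => s ^+ n) s * Re (c * rising_ratio y n * cpow (1 - s) y)).
  apply/funext => s; rewrite /binomial_sum big_ord_recr/= mulrDr mulrDr ReD.
  congr (_ + _); rewrite /= [RHS]mulrC -ReMr; congr Re; ring.
have hB : is_derive r 1 (fun s : R => 1 - s) (-1).
  by apply: is_derive_eq; rewrite add0r mul1r.
have hX : is_derive r 1 (fun s : R => s ^+ n) (n%:R * r ^+ n.-1).
  apply: DeriveDef; first exact: exprn_derivable.
  by rewrite exp_derive /GRing.scale /= mulr1.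
have h1r : 0 < 1 - r by rewrite subr_gt0.
have hP := @is_derive1_comp _ (fun s => Re (c * rising_ratio y n * cpow s y))
  (fun s : R => 1 - s) r _ _ (is_derive_Re_cpow _ _ h1r) hB.
apply: (is_derive_eq (is_deriveD IH (is_deriveM hX hP))).
rewrite /GRing.scale /= rising_ratioS.
have -> : cpow (1 - r) y = cpow (1 - r) (y - 1) * (1 - r)%:C.
  by rewrite -(cpow_id h1r) -cpowD subrK.
have -> : (y + n%:R) / n.+1%:R = (y + n%:R) * ((n.+1%:R)^-1)%:C.
  by rewrite fmorphV rmorph_nat.
set P := cpow _ _; set A := rising_ratio _ _.
rewrite (_ : c * A * (P * (1 - r)%:C) = c * (P * A) * (1 - r)%:C); last by ring.
rewrite (_ : c * A * y * P = c * (P * A) * y); last by ring.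
rewrite (_ : c * (P * (A * _)) = c * (P * A) * (y + n%:R) * (n.+1%:R^-1)%:C); last by ring.
set Z := c * _.
have hZ : Re (Z * (y + n%:R)) = Re (Z * y) + Re Z * n%:R.
  by rewrite mulrDr ReD -(rmorph_nat (real_complex R)) ReMr.
rewrite !ReMr hZ.
have hn : (n.+1%:R : R) != 0 by [].
case: (n) hn => [|m] hn /=; first by rewrite !expr0; field.
by rewrite !exprS; field.
Qed.

Lemma continuous_binomial_sum y c n r : 0 <= r < 1 ->
  {within `[0, r], continuous (fun s => Re (c * (cpow (1 - s) y * binomial_sum y n s)))}.
Proof.
move=> /andP[r0 r1]; apply: continuous_in_subspaceT => s /[!inE]/=.
rewrite in_itv/= => /andP[_ sr].
apply/differentiable_continuous/derivable1_diffP.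
by case: (is_derive_binomial_sum y c n (le_lt_trans sr r1)).
Qed.

(** For b >= 0 the derivative of (1 - r)^b S_n(r) is nonpositive, and its value at
    r = 0 is at most 1. *)
Lemma binomial_sum_le b n r : 0 <= b -> 0 <= r < 1 ->
  \sum_(k < n) rising_ratio b k * r ^+ k <= (1 - r) `^ (- b).
Proof.
move=> b0 /andP[r0 r1]; have h1r : 0 < 1 - r by rewrite subr_gt0.
set S := \sum_(_ < _) _.
have SE s : binomial_sum b%:C n s = (\sum_(k < n) rising_ratio b k * s ^+ k)%:C.
  by rewrite /binomial_sum rmorph_sum; apply: eq_bigr => k _; rewrite rmorphM rising_ratioR.
suff : (1 - r) `^ b * S <= 1.
  by rewrite powRN -[X in _ -> _ <= X]mul1r ler_pdivlMr ?powR_gt0// mulrC.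
pose f s := Re (1 * (cpow (1 - s) b%:C * binomial_sum b%:C n s)).
have fE s : s < 1 -> f s = (1 - s) `^ b * \sum_(k < n) rising_ratio b k * s ^+ k.
  by move=> s1; rewrite /f mul1r SE ReMr cpowR// subr_gt0.
have hd s : s \in `]0, r[ -> is_derive s 1 f _ := fun hs =>
  is_derive_binomial_sum b%:C 1 n (lt_trans (proj2 (andP hs)) r1).
have r01 : 0 <= r < 1 by rewrite r0.
have [s] := MVT_segment r0 hd (@continuous_binomial_sum b%:C 1 n r r01).
rewrite in_itv /= => /andP[s0 sr] => hf.
have : f r - f 0 <= 0.
  rewrite hf mulNr oppr_le0 !mulr_ge0// ?exprn_ge0// ?subr0//.
  have s1 : 0 < 1 - s by rewrite subr_gt0 (le_lt_trans sr).
  have -> : b%:C - 1 = (b - 1)%:C by rewrite rmorphB rmorph1.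
  rewrite mul1r cpowR// rising_ratioR.
  by rewrite ReMr mulr_ge0 ?powR_ge0 ?rising_ratio_ge0.
rewrite !fE// subr_le0 => /le_trans; apply.
rewrite subr0 powR1 mul1r; case: (n) => [|m]; first by rewrite big_ord0.
rewrite big_ord_recl rising_ratio0 expr0 mul1r big1 ?addr0// => k _.
by rewrite /bump /= exprS mul0r mulr0.
Qed.

Lemma normc_binomial_sum y n r : 0 <= r < 1 ->
  normc (binomial_sum y n r) <= (1 - r) `^ (- normc y).
Proof.
move=> r01; apply: le_trans (normc_sum _ _ _) _.
apply: le_trans (binomial_sum_le n (normc_ge0 y) r01).
case/andP: r01 => r0 _; apply: ler_sum => k _.
rewrite normcM normcR ger0_norm ?exprn_ge0//.
by rewrite ler_wpM2r ?exprn_ge0// normc_rising_ratio.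
Qed.

Lemma rising_ratio2 k : rising_ratio (2 : R) k = k.+1%:R.
Proof.
elim: k => [|k IH]; first by rewrite rising_ratio0.
rewrite rising_ratioS IH mulrCA divff ?mulr1// -natrD; congr (_%:R).
Qed.

(** The terms (k + 1) r^k are those of the binomial series with exponent -2,
    whose partial sums are bounded. *)
Lemma cvg_nat_expr r : 0 <= r < 1 -> n%:R * r ^+ n.-1 @[n --> \oo] --> (0 : R).
Proof.
move=> r01; have /andP[r0 r1] := r01; rewrite -cvg_shiftS /=.
apply: cvg_series_cvg_0; apply: nondecreasing_is_cvgn.
  by apply/nondecreasing_seqP => n; rewrite seriesSr lerDl mulr_ge0// exprn_ge0.
exists ((1 - r) `^ (- 2)) => _ [n _ <-] /=.
rewrite /series /= big_mkord (le_trans _ (@binomial_sum_le 2 n r _ r01))//.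
by apply: ler_sum => k _; rewrite rising_ratio2.
Qed.

Lemma binomial_sum_at0 y n : binomial_sum y n.+1 0 = 1.
Proof.
rewrite /binomial_sum big_ord_recl rising_ratio0 expr0 mul1r big1 ?addr0// => k _.
by rewrite /bump /= exprS mul0r rmorph0 mulr0.
Qed.

(** Mean value inequality on [0, r]; as |y| < 1, the coefficients have modulus at
    most 1 and (1 - s)^(Re y - 1) is largest at s = r. *)
Lemma binomial_defect_le y c n r : normc y < 1 -> 0 <= r < 1 ->
  `|Re (c * (cpow (1 - r) y * binomial_sum y n.+1 r - 1))| <=
  normc c * (1 - r) `^ (Re y - 1) * (n.+1%:R * r ^+ n).
Proof.
move=> y1 r01; have /andP[r0 r1] := r01.
pose f s := Re (c * (cpow (1 - s) y * binomial_sum y n.+1 s)).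
have hd s : s \in `]0, r[ -> is_derive s 1 f _ := fun hs =>
  is_derive_binomial_sum y c n.+1 (lt_trans (proj2 (andP hs)) r1).
have [s] := MVT_segment r0 hd (@continuous_binomial_sum y c n.+1 r r01).
rewrite in_itv /= => /andP[s0 sr] => hf.
have -> : Re (c * (cpow (1 - r) y * binomial_sum y n.+1 r - 1)) = f r - f 0.
  by rewrite /f subr0 cpow1 binomial_sum_at0 mulrBr ReD ReN mulr1.
rewrite hf subr0 mulNr normrN !normrM [ `|r|]ger0_norm// [ `|s ^+ n|]ger0_norm ?exprn_ge0//.
rewrite normr_nat -[leRHS]mulr1 ler_pM ?mulr_ge0 ?exprn_ge0//; last exact: ltW.
rewrite mulrC ler_pM ?mulr_ge0 ?exprn_ge0//; last first.
  by rewrite mulrC ler_wpM2l// lerXn2r// ?nnegrE.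
apply: le_trans (normc_Re _) _; rewrite normcM (normcM (cpow _ _)) ler_wpM2l ?normc_ge0//.
have s1 : 0 < 1 - s by rewrite subr_gt0 (le_lt_trans sr).
have h1r : 0 < 1 - r by rewrite subr_gt0.
rewrite normc_cpow// ReD ReN /= -[leRHS]mulr1 ler_pM ?powR_ge0 ?normc_ge0//; last first.
  apply: le_trans (normc_rising_ratio _ _) _.
  by rewrite rising_ratio_le1// normc_ge0 ltW.
rewrite -[Re y - 1]opprK ![_ `^ (- - _)]powRN lef_pV2 ?posrE ?powR_gt0//.
rewrite ge0_ler_powR ?nnegrE ?lerD2l ?lerN2 ?(ltW h1r) ?(ltW s1)// oppr_ge0 subr_le0 ltW//.
by rewrite (le_lt_trans _ y1)// (le_trans (ler_norm _))// normc_Re.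
Qed.

Lemma binomial_series y r : normc y < 1 -> 0 <= r < 1 ->
  normc (binomial_sum y n r - cpow (1 - r) (- y)) @[n --> \oo] --> (0 : R).
Proof.
move=> y1 r01; have h1r : 0 < 1 - r by rewrite subr_gt0; case/andP: r01.
pose M := normc (cpow (1 - r) (- y)) * (2 * (1 - r) `^ (Re y - 1)).
have hM : M * (n%:R * r ^+ n.-1) @[n --> \oo] --> (0 : R).
  by rewrite -(mulr0 M); apply: cvgM; [exact: cvg_cst|exact: cvg_nat_expr].
apply: (squeeze_cvgr _ (cvg_cst 0) hM); near=> n; rewrite normc_ge0/=.
have -> : n = n.-1.+1 by rewrite prednK//; near: n; exact: nbhs_infty_gt.
set m := n.-1.
rewrite (_ : _ - _ = cpow (1 - r) (- y) * (cpow (1 - r) y * binomial_sum y m.+1 r - 1)).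
  rewrite (normcM (cpow _ _)) /M -(mulrA (normc _)) -(mulrA 2) ler_wpM2l ?normc_ge0//.
  apply: le_trans (normc_le_ReIm _) _; rewrite [leRHS]mulr_natl mulr2n lerD//.
    have := binomial_defect_le 1 m y1 r01.
    by rewrite !mul1r ComplexField.Normc.normc1 mul1r.
  have := binomial_defect_le (- 'i) m y1 r01.
  rewrite mulNr ReN mulrC ReiNIm opprK => /le_trans; apply.
  have -> : normc (- 'i : R[i]) = 1 by rewrite /= oppr0 expr0n /= add0r sqrrN expr1n sqrtr1.
  by rewrite mul1r.
by rewrite mulrBr mulr1 mulrA cpowNK mul1r.
Unshelve. all: by end_near. Qed.

End rising_ratio_theory.

(** * Limits and integrals of complex-valued functions *)

Definition cint d (T : measurableType d) (R : realType)
    (mu : {measure set T -> \bar R}) (f : T -> R[i]) : R[i] :=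
  (\int[mu]_x Re (f x)) +i* (\int[mu]_x Im (f x)).

Definition cmeasurable d (T : measurableType d) (R : realType) (f : T -> R[i]) :=
  measurable_fun setT (fun x => Re (f x)) /\ measurable_fun setT (fun x => Im (f x)).

Definition cintegrable d (T : measurableType d) (R : realType)
    (mu : {measure set T -> \bar R}) (f : T -> R[i]) :=
  mu.-integrable setT (EFin \o (fun x => Re (f x))) /\
  mu.-integrable setT (EFin \o (fun x => Im (f x))).

(** Convergence of complex sequences, measured by a real-valued distance. *)
Definition ccvg (R : realType) (u : nat -> R[i]) (l : R[i]) :=
  normc (u n - l) @[n --> \oo] --> (0 : R).

Section complex_limits.
Variable R : realType.
Implicit Types (u v : nat -> R[i]) (l m c : R[i]).

Lemma ccvg_ReIm u l : (Re (u n) @[n --> \oo] --> Re l) ->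
  (Im (u n) @[n --> \oo] --> Im l) -> ccvg u l.
Proof.
move=> hr hi.
have h : `|Re (u n) - Re l| + `|Im (u n) - Im l| @[n --> \oo] --> (0 : R).
  rewrite -[X in _ --> X](addr0 0); apply: cvgD; rewrite -(normr0 R);
    by apply: cvg_norm; apply/subr_cvg0.
apply: (squeeze_cvgr _ (cvg_cst 0) h); apply: nearW => n.
by rewrite normc_ge0 (le_trans (normc_le_ReIm _))// ReD ImD ReN ImN.
Qed.

Lemma ccvg_Re u l : ccvg u l -> Re (u n) @[n --> \oo] --> Re l.
Proof.
move=> h; apply/subr_cvg0; apply/norm_cvg0P.
apply: (squeeze_cvgr _ (cvg_cst 0) h); apply: nearW => n.
by rewrite normr_ge0 -ReN -ReD normc_Re.
Qed.

Lemma ccvg_Im u l : ccvg u l -> Im (u n) @[n --> \oo] --> Im l.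
Proof.
move=> h; apply/subr_cvg0; apply/norm_cvg0P.
apply: (squeeze_cvgr _ (cvg_cst 0) h); apply: nearW => n.
by rewrite normr_ge0 -ImN -ImD normc_Im.
Qed.

Lemma ccvg_unique u l m : ccvg u l -> ccvg u m -> l = m.
Proof.
move=> hl hm; apply: complex_eq.
  exact: (cvg_unique _ (ccvg_Re hl) (ccvg_Re hm)).
exact: (cvg_unique _ (ccvg_Im hl) (ccvg_Im hm)).
Qed.

Lemma ccvgZ c u l : ccvg u l -> ccvg (fun n => c * u n) (c * l).
Proof.
move=> h; rewrite /ccvg; under eq_fun do rewrite -mulrBr normcM.
by rewrite -(mulr0 (normc c)); apply: cvgM; [exact: cvg_cst|].
Qed.

Lemma ccvgB u v l m : ccvg u l -> ccvg v m -> ccvg (fun n => u n - v n) (l - m).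
Proof.
move=> hl hm; apply: ccvg_ReIm.
  rewrite ReD ReN; under eq_fun do rewrite ReD ReN.
  by apply: cvgB; apply: ccvg_Re.
rewrite ImD ImN; under eq_fun do rewrite ImD ImN.
by apply: cvgB; apply: ccvg_Im.
Qed.

End complex_limits.

Section complex_integral.
Context d (T : measurableType d) (R : realType).
Variable mu : {measure set T -> \bar R}.
Implicit Types (f g : T -> R[i]) (c : R[i]).

Lemma cmeasurableM f g : cmeasurable f -> cmeasurable g ->
  cmeasurable (fun x => f x * g x).
Proof.
move=> [fr fi] [gr gi]; split.
  by under eq_fun do rewrite ReM; apply: measurable_funB; apply: measurable_funM.
by under eq_fun do rewrite ImM; apply: measurable_funD; apply: measurable_funM.
Qed.

Lemma cmeasurable_cst c : cmeasurable (fun _ : T => c).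
Proof. by split; exact: measurable_cst. Qed.

Lemma cmeasurableR (h : T -> R) : measurable_fun setT h ->
  cmeasurable (fun x => (h x)%:C).
Proof. by move=> mh; split => //=; exact: measurable_cst. Qed.

Lemma cmeasurable_sum n (F : nat -> T -> R[i]) : (forall k, cmeasurable (F k)) ->
  cmeasurable (fun x => \sum_(k < n) F k x).
Proof.
move=> h; split.
  under eq_fun do rewrite Re_sum.
  by apply: measurable_sum => k; exact: (h k).1.
under eq_fun do rewrite Im_sum.
by apply: measurable_sum => k; exact: (h k).2.
Qed.

Lemma cintegrable_meas f : cintegrable mu f -> cmeasurable f.
Proof. by case=> /measurable_int/measurable_EFinP ? /measurable_int/measurable_EFinP. Qed.

Lemma cintegrable_dominated f (g : T -> R) : cmeasurable f ->
  mu.-integrable setT (EFin \o g) -> (forall x, normc (f x) <= g x) ->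
  cintegrable mu f.
Proof.
move=> [mr mi] ig fg; split; apply: (le_integrable _ _ _ ig) => //;
  try exact/measurable_EFinP; move=> x _ /=; rewrite lee_fin.
  apply: le_trans (normc_Re _) _; apply: le_trans (fg x) _; exact: ler_norm.
apply: le_trans (normc_Im _) _; apply: le_trans (fg x) _; exact: ler_norm.
Qed.

Lemma cintegrableZ c f : cintegrable mu f -> cintegrable mu (fun x => c * f x).
Proof.
move=> [ir ii]; split.
  rewrite (_ : _ \o _ = (fun x => (Re c)%:E * (EFin \o (fun x => Re (f x))) x -
    (Im c)%:E * (EFin \o (fun x => Im (f x))) x)%E); last first.
    by apply/funext => x /=; rewrite ReM.
  by apply: integrableB => //; apply: integrableZl.
rewrite (_ : _ \o _ = (fun x => (Re c)%:E * (EFin \o (fun x => Im (f x))) x +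
  (Im c)%:E * (EFin \o (fun x => Re (f x))) x)%E); last first.
  by apply/funext => x /=; rewrite ImM.
by apply: integrableD => //; apply: integrableZl.
Qed.

Lemma cintZ c f : cintegrable mu f -> cint mu (fun x => c * f x) = c * cint mu f.
Proof.
move=> [ir ii]; rewrite /cint; apply: complex_eq; rewrite !(ReM, ImM) /=.
  under eq_Rintegral do rewrite ReM.
  rewrite RintegralB//; [|exact: (integrableZl _ _ ir)|exact: (integrableZl _ _ ii)].
  by rewrite !RintegralZl.
under eq_Rintegral do rewrite ImM.
rewrite RintegralD//; [|exact: (integrableZl _ _ ii)|exact: (integrableZl _ _ ir)].
by rewrite !RintegralZl.
Qed.

Lemma eq_cint f g : f =1 g -> cint mu f = cint mu g.
Proof. by move=> /funext ->. Qed.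

Lemma cint0 : cint mu (fun=> 0) = 0.
Proof.
by rewrite /cint /Rintegral /= integral0.
Qed.

Lemma cintegrable0 : cintegrable mu (fun=> 0).
Proof. by split; exact: integrable0. Qed.

Lemma cintegrableD f g : cintegrable mu f -> cintegrable mu g ->
  cintegrable mu (fun x => f x + g x).
Proof.
move=> [fr fi] [gr gi]; split.
  by under eq_fun do rewrite ReD; exact: (integrableD _ fr gr).
by under eq_fun do rewrite ImD; exact: (integrableD _ fi gi).
Qed.

Lemma cintD f g : cintegrable mu f -> cintegrable mu g ->
  cint mu (fun x => f x + g x) = cint mu f + cint mu g.
Proof.
move=> [fr fi] [gr gi]; rewrite /cint; apply: complex_eq; rewrite !(ReD, ImD) /=.
  by under eq_Rintegral do rewrite ReD; rewrite RintegralD.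
by under eq_Rintegral do rewrite ImD; rewrite RintegralD.
Qed.

Lemma cint_sum n (F : nat -> T -> R[i]) : (forall k, cintegrable mu (F k)) ->
  cint mu (fun x => \sum_(k < n) F k x) = \sum_(k < n) cint mu (F k).
Proof.
move=> h.
suff [] : cintegrable mu (fun x => \sum_(k < n) F k x) /\
  cint mu (fun x => \sum_(k < n) F k x) = \sum_(k < n) cint mu (F k) by [].
elim: n => [|n [IH1 IH2]].
  have -> : (fun x => \sum_(k < 0) F k x) = (fun=> 0).
    by apply/funext => x; rewrite big_ord0.
  by rewrite big_ord0 cint0; split => //; exact: cintegrable0.
have -> : (fun x => \sum_(k < n.+1) F k x) = (fun x => \sum_(k < n) F k x + F n x).
  by apply/funext => x; rewrite big_ord_recr.
split; first exact: cintegrableD.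
by rewrite cintD// IH2 big_ord_recr.
Qed.

Lemma cint_dominated_cvg (F : nat -> T -> R[i]) f (g : T -> R) :
  (forall n, cmeasurable (F n)) -> (forall x, ccvg (F ^~ x) (f x)) ->
  mu.-integrable setT (EFin \o g) -> (forall n x, normc (F n x) <= g x) ->
  ccvg (fun n => cint mu (F n)) (cint mu f).
Proof.
move=> mF Ff ig Fg.
have main (P : R[i] -> R) : (forall n, measurable_fun setT (fun x => P (F n x))) ->
    (forall x, P (F n x) @[n --> \oo] --> P (f x)) ->
    (forall z, `|P z| <= normc z) ->
    (\int[mu]_x P (F n x)) @[n --> \oo] --> \int[mu]_x P (f x).
  move=> mP cP lP.
  have mF' n : measurable_fun setT (fun x => (P (F n x))%:E) by exact/measurable_EFinP.
  have c' x : setT x -> (P (F n x))%:E @[n --> \oo] --> (P (f x))%:E.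
    by move=> _; apply: cvg_EFin; [exact: nearW|exact: cP].
  have l' n x : setT x -> (`|(P (F n x))%:E| <= (g x)%:E)%E.
    by move=> _; rewrite lee_fin (le_trans (lP _)).
  have mf' := emeasurable_fun_cvg _ _ mF' c'.
  have [if_ _ h] := dominated_convergence measurableT mF' mf'
    (aeW mu c') ig (aeW mu (fun x n => l' n x)).
  by apply: fine_cvg; rewrite fineK//; exact: integrable_fin_num.
apply: ccvg_ReIm.
  apply: main => [n|x|z]; [exact: (mF n).1|exact: ccvg_Re|exact: normc_Re].
apply: main => [n|x|z]; [exact: (mF n).2|exact: ccvg_Im|exact: normc_Im].
Qed.

End complex_integral.

Lemma cmeasurable_comp d1 d2 (T1 : measurableType d1) (T2 : measurableType d2)
    (R : realType) (f : T2 -> R[i]) (h : T1 -> T2) :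
  cmeasurable f -> measurable_fun setT h -> cmeasurable (f \o h).
Proof.
by move=> [fr fi] mh; split; [exact: (measurableT_comp fr)|exact: (measurableT_comp fi)].
Qed.

Section complex_fubini.
Context d1 d2 (T1 : measurableType d1) (T2 : measurableType d2) (R : realType).
Variables (m1 : {sigma_finite_measure set T1 -> \bar R})
  (m2 : {sigma_finite_measure set T2 -> \bar R}).

(** The inner integral is finite only almost everywhere, which is where its
    real-valued version can be identified with the extended one. *)
Lemma Rintegral12_prod (f : T1 * T2 -> R) :
  (m1 \x m2)%E.-integrable setT (EFin \o f) ->
  \int[m1]_x \int[m2]_y f (x, y) = \int[(m1 \x m2)%E]_z f z.
Proof.
move=> fi; rewrite /Rintegral -(integral12_prod_meas1 fi); congr fine.
have mF := measurable_fubini_F fi.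
apply: ae_eq_integral => //.
  by apply/measurable_EFinP; exact: (measurableT_comp (@fine_measurable R setT measurableT) mF).
have [N [mN N0 hN]] := ae_integrable1 fi.
exists N; split => // x /= hx; apply: hN => /= hi; apply: hx => _.
by rewrite fineK//; apply: integrable_fin_num.
Qed.

Lemma Rintegral21_prod (f : T1 * T2 -> R) :
  (m1 \x m2)%E.-integrable setT (EFin \o f) ->
  \int[m2]_y \int[m1]_x f (x, y) = \int[(m1 \x m2)%E]_z f z.
Proof.
move=> fi; rewrite /Rintegral -(integral21_prod_meas1 fi); congr fine.
have mF := measurable_fubini_G fi.
apply: ae_eq_integral => //.
  by apply/measurable_EFinP; exact: (measurableT_comp (@fine_measurable R setT measurableT) mF).
have [N [mN N0 hN]] := ae_integrable2 fi.
exists N; split => // x /= hx; apply: hN => /= hi; apply: hx => _.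
by rewrite fineK//; apply: integrable_fin_num.
Qed.

Lemma cint12_prod (f : T1 * T2 -> R[i]) : cintegrable (m1 \x m2)%E f ->
  cint m1 (fun x => cint m2 (fun y => f (x, y))) = cint (m1 \x m2)%E f.
Proof.
by move=> [fr fi]; apply: complex_eq; [exact: (Rintegral12_prod fr)|exact: (Rintegral12_prod fi)].
Qed.

Lemma cint21_prod (f : T1 * T2 -> R[i]) : cintegrable (m1 \x m2)%E f ->
  cint m2 (fun y => cint m1 (fun x => f (x, y))) = cint (m1 \x m2)%E f.
Proof.
by move=> [fr fi]; apply: complex_eq; [exact: (Rintegral21_prod fr)|exact: (Rintegral21_prod fi)].
Qed.

Lemma integrable_prodM (f : T1 -> R) (g : T2 -> R) :
  m1.-integrable setT (EFin \o f) -> m2.-integrable setT (EFin \o g) ->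
  (m1 \x m2)%E.-integrable setT (EFin \o (fun z => f z.1 * g z.2)).
Proof.
move=> fi gi.
have mf : measurable_fun setT f by move/measurable_int/measurable_EFinP : fi.
have mg : measurable_fun setT g by move/measurable_int/measurable_EFinP : gi.
apply/integrable12ltyP.
  apply/measurable_EFinP; apply: measurable_funM.
    exact: (measurableT_comp mf).
  exact: (measurableT_comp mg).
have gE x : (\int[m2]_y `|(EFin \o (fun z => (f z.1 * g z.2)%R)) (x, y)| =
   (`|f x| * fine (\int[m2]_y `|(g y)%:E|))%:E)%E.
  rewrite EFinM fineK; last first.
    by apply: integrable_fin_num => //; exact: integrable_abse gi.
  rewrite -ge0_integralZl//; first by apply: eq_integral => y _ /=; rewrite normrM EFinM.
  by apply: measurableT_comp => //; exact/measurable_EFinP.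
under eq_integral do rewrite gE EFinM.
rewrite integralZr//; last exact: integrable_abse fi.
case/integrableP : (fi) => _ fl.
by rewrite muleC lte_mul_pinfty// lee_fin fine_ge0// integral_ge0.
Qed.

End complex_fubini.

(** * Powers on the half-line and translations *)

Section half_line_powers.
Variable R : realType.
Local Notation mu := (@lebesgue_measure R).
Implicit Types (a z c : R[i]) (t u w p k s e : R).

(** Powers extended by 0 to the nonpositive reals, so that integrals over the
    half-line and over plane domains become integrals over the whole space. *)
Definition ppow t z : R[i] := if 0 < t then cpow t z else 0.
Definition rpow t p : R := if 0 < t then t `^ p else 0.

Lemma ppowE t z : 0 < t -> ppow t z = cpow t z.
Proof. by rewrite /ppow => ->. Qed.

Lemma ppow_le0 t z : t <= 0 -> ppow t z = 0.
Proof. by rewrite /ppow ltNge => ->. Qed.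

Lemma rpow_ge0 t p : 0 <= rpow t p.
Proof. by rewrite /rpow; case: ifP => // _; exact: powR_ge0. Qed.

Lemma normc_ppow t z : normc (ppow t z) = rpow t (Re z).
Proof.
rewrite /ppow /rpow; case: ifP => t0; last exact: ComplexField.Normc.normc0.
exact: normc_cpow.
Qed.

Lemma ppowR t p : ppow t p%:C = (rpow t p)%:C.
Proof. by rewrite /ppow /rpow; case: ifP => // t0; exact: cpowR. Qed.

Lemma ppowD t z a : ppow t (z + a) = ppow t z * ppow t a.
Proof. by rewrite /ppow; case: ifP => _; rewrite ?mul0r// cpowD. Qed.

Lemma rpowD t p s : rpow t (p + s) = rpow t p * rpow t s.
Proof.
rewrite /rpow; case: ifP => t0; rewrite ?mul0r// powRD//.
by rewrite (gt_eqF t0) implybT.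
Qed.

Lemma measurable_cos_R : measurable_fun setT (@cos R).
Proof. by apply: continuous_measurable_fun; exact: continuous_cos. Qed.

Lemma measurable_sin_R : measurable_fun setT (@sin R).
Proof. by apply: continuous_measurable_fun; exact: continuous_sin. Qed.

Lemma measurable_gt0 : measurable_fun setT (fun t : R => 0 < t).
Proof. by exact: measurable_fun_ltr. Qed.

Lemma measurable_cpow z : cmeasurable (fun t : R => cpow t z).
Proof.
have mln (b : R) : measurable_fun setT (fun t : R => b * ln t).
  by apply: measurable_funM => //; exact: measurable_ln.
rewrite /cpow /cexp; apply: cmeasurableM.
  apply: cmeasurableR; under eq_fun do rewrite ReMr.
  exact: (measurableT_comp (@measurable_expR R)).
split; under eq_fun do rewrite /= ImMr.
  exact: (measurableT_comp measurable_cos_R).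
exact: (measurableT_comp measurable_sin_R).
Qed.

Lemma measurable_ppow z : cmeasurable (fun t : R => ppow t z).
Proof.
rewrite /ppow; have [mr mi] := measurable_cpow z; split.
  under eq_fun do rewrite (fun_if (@Re R)).
  by apply: measurable_fun_ifT => //; exact: measurable_gt0.
under eq_fun do rewrite (fun_if (@Im R)).
by apply: measurable_fun_ifT => //; exact: measurable_gt0.
Qed.

Lemma measurable_rpow p : measurable_fun setT (fun t : R => rpow t p).
Proof.
by apply: measurable_fun_ifT => //; exact: measurable_gt0.
Qed.

Lemma integral_itv_if (g : R -> R) e w :
  (\int[mu]_t (if e <= t < w then g t else 0)%:E = \int[mu]_(t in `[e, w[) (g t)%:E)%E.
Proof.
rewrite [RHS]integral_mkcond; congr integral; apply/funext => t.
by rewrite patchE mem_setE in_itv/=; case: ifP.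
Qed.

(** Fundamental theorem of calculus, away from the singularity at 0. *)
Lemma integral_Re_cpow c a e w : 0 < e < w -> a != 0 ->
  (\int[mu]_(t in `[e, w[) (Re (c * cpow t (a - 1)))%:E =
   (Re (c * (cpow w a - cpow e a) / a))%:E)%E.
Proof.
move=> /andP[e0 ew] a0.
have w0 := lt_trans e0 ew.
rewrite integral_itv_bndo_bndc; last first.
  apply/measurable_EFinP; apply: measurable_funTS.
  have [m _] := cmeasurableM (cmeasurable_cst _ c) (measurable_cpow (a - 1)).
  exact: m.
rewrite (@continuous_FTC2 _ _ (fun t => Re (c / a * cpow t a))) //.
- rewrite -EFinB -ReN -ReD; congr (Re _)%:E; field => //.
- apply: continuous_in_subspaceT => t /[!inE]/=; rewrite in_itv/= => /andP[et _].
  by apply: continuous_Re_cpow; exact: lt_le_trans et.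
- have hc t : 0 < t -> {for t, continuous (fun t => Re (c / a * cpow t a))}.
    exact: continuous_Re_cpow.
  split.
  + move=> t; rewrite in_itv/= => /andP[et _].
    by case: (is_derive_Re_cpow (c / a) a (lt_trans e0 et)).
  + by apply: cvg_at_right_filter; exact: hc.
  + by apply: cvg_at_left_filter; exact: hc.
- move=> t; rewrite in_itv/= => /andP[et _].
  have [_ dE] := is_derive_Re_cpow (c / a) a (lt_trans e0 et).
  by rewrite derive1E dE divfK.
Qed.

End half_line_powers.

Section translation.
Variable R : realType.
Local Notation mu := (@lebesgue_measure R).

Lemma lebesgue_measure_translation (t : R) (A : set (measurableTypeR R)) :
  measurable A -> mu A = mu ((fun u => t + u) @^-1` A).
Proof.
have mphi : measurable_fun [set: measurableTypeR R]
    (fun u : measurableTypeR R => t + u : measurableTypeR R).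
  by apply: measurable_funD.
pose nu0 : {measure set (measurableTypeR R) -> \bar R} :=
  pushforward mu (fun u : measurableTypeR R => t + u : measurableTypeR R).
pose nu := nu0 mphi.
suff h X : ocitv X -> mu X = nu X by move=> mA; exact: (lebesgue_measure_unique h).
move=> [[a b] _ <-] /=.
rewrite /nu/nu0/= /pushforward (_ : _ @^-1` _ = `]a - t, b - t]%classic); last first.
  by apply/seteqP; split => u /=; rewrite !in_itv/= ltrBlDl lerBrDl.
by rewrite !lebesgue_measure_itv/= !lte_fin ltrD2r -!EFinB opprB addrA subrK.
Qed.

Lemma integral_translation (f : R -> R) (t : R) : measurable_fun setT f ->
  (\int[mu]_u (f (t + u)%R)%:E = \int[mu]_w (f w)%:E)%E.
Proof.
move=> mf.
have mphi : measurable_fun [set: measurableTypeR R]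
    (fun u : measurableTypeR R => t + u : measurableTypeR R).
  by apply: measurable_funD.
have ge0 (g : R -> \bar R) : measurable_fun setT g -> (forall x, 0 <= g x)%E ->
    (\int[mu]_u g (t + u)%R = \int[mu]_w g w)%E.
  move=> mg g0.
  have := @ge0_integral_pushforward _ _ _ _ R _ mphi mu setT g measurableT mg
    (fun y _ => g0 y).
  rewrite preimage_setT => <-.
  by apply: eq_measure_integral => A mA _; exact/esym/lebesgue_measure_translation.
have mE : measurable_fun setT (EFin \o f) by exact/measurable_EFinP.
have hp := ge0 _ (measurable_funepos mE) (funepos_ge0 (EFin \o f)).
have hn := ge0 _ (measurable_funeneg mE) (funeneg_ge0 (EFin \o f)).
by rewrite integralE [RHS]integralE -hp -hn !unlock.
Qed.

Lemma cint_translation (f : R -> R[i]) (t : R) : cmeasurable f ->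
  cint mu (fun u => f (t + u)) = cint mu f.
Proof.
by move=> [mr mi]; apply: complex_eq; rewrite /= /Rintegral;
  congr fine; exact: integral_translation.
Qed.

End translation.

(** * Euler's kernel on the half-line *)

Section gamma_integrals.
Variable R : realType.
Local Notation mu := (@lebesgue_measure R).
Implicit Types (a z c : R[i]) (t u w p k s e : R).

Lemma cGammaE z : cGamma z = cint mu (fun t => ppow t (z - 1) * (expR (- t))%:C).
Proof.
have E (t : measurableTypeR R) : (t \in `]0, +oo[) = (0 < t) by rewrite in_itv/= andbT.
rewrite /cGamma /cint; congr (_ +i* _); rewrite Rintegral_mkcond; congr Rintegral;
  apply/funext => t; rewrite patchE mem_setE E /ppow;
  by case: ifP => _; rewrite ?mul0r// -(rmorphN (real_complex R) t) cexpR.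
Qed.

(** Lower endpoints tending to 0, to reach the singularity of t^(a-1) at 0. *)
Definition cutoff w (n : nat) : R := w / n.+2%:R.

Lemma cutoff_gt0 w n : 0 < w -> 0 < cutoff w n.
Proof. by move=> w0; rewrite divr_gt0. Qed.

Lemma cutoff_lt w n : 0 < w -> cutoff w n < w.
Proof. by move=> w0; rewrite ltr_pdivrMr// ltr_pMr// ltr1n. Qed.

Lemma cutoff_cvg w : cutoff w n @[n --> \oo] --> (0 : R).
Proof.
rewrite -(mulr0 w); apply: cvgM; first exact: cvg_cst.
have h : n.+1%:R^-1 @[n --> \oo] --> (0 : R) by exact: cvg_harmonic.
rewrite -cvg_shiftS in h; exact: h.
Qed.

Lemma cutoff_powR w p : 0 < w -> 0 < p -> cutoff w n `^ p @[n --> \oo] --> (0 : R).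
Proof.
move=> w0 p0; have /cvg_at_rightP := @powR_cvg0 R p p0; apply; split.
  by move=> n; exact: cutoff_gt0.
exact: cutoff_cvg.
Qed.

Definition cut_fun (f : R -> R) w n t : R := if cutoff w n <= t < w then f t else 0.

Lemma near_cutoff w t : 0 < t -> \forall n \near \oo, cutoff w n <= t.
Proof.
move=> t0; have /cvgrPdist_lt/(_ _ t0) := cutoff_cvg w.
by apply: filterS => n; rewrite sub0r normrN => h; rewrite ltW// (le_lt_trans (ler_norm _)).
Qed.

Lemma cutoff_le w n m : 0 < w -> (n <= m)%N -> cutoff w m <= cutoff w n.
Proof.
move=> w0 nm; rewrite /cutoff ler_pM2l// -[m.+2%:R^-1]div1r ler_pdivrMr// mulrC.
by rewrite ler_pdivlMr// mul1r ler_nat.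
Qed.

(** Monotone convergence on the intervals [w/(n+2), w[, where the integral is
    (w^s - (w/(n+2))^s) / s. *)
Lemma rpow_cut_integral_le s w : 0 < s ->
  (\int[mu]_t (rpow t (s - 1) * (t < w)%R%:R)%R%:E <= (rpow w s / s)%R%:E)%E.
Proof.
move=> s0; have [w0|w0] := ltP 0 w; last first.
  rewrite integral0_eq; last first.
    move=> t _; rewrite /rpow; case: ifP => [t0|_]; last by rewrite mul0r.
    by rewrite ltNge (le_trans w0 (ltW t0)) mulr0.
  by rewrite lee_fin divr_ge0 ?rpow_ge0 ?ltW.
pose g n t := (cut_fun (fun t => Re (1 * cpow t (s%:C - 1))) w n t)%:E.
have mg n : measurable_fun setT (g n).
  apply/measurable_EFinP; apply: measurable_fun_ifT => //.
    by apply: measurable_and => //; exact: measurable_fun_ler || exact: measurable_fun_ltr.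
  have [m _] := cmeasurableM (cmeasurable_cst _ 1) (measurable_cpow (s%:C - 1)).
  exact: m.
have gE n t : 0 < t -> g n t = (if cutoff w n <= t < w then t `^ (s - 1) else 0)%:E.
  move=> t0; rewrite /g /cut_fun mul1r.
  by rewrite -[1]/((1 : R)%:C) -rmorphB cpowR.
have cF n t : t <= 0 -> (cutoff w n <= t) = false.
  by move=> t0; rewrite leNgt (le_lt_trans t0 (cutoff_gt0 n w0)).
have g0 n t : (0 <= g n t)%E.
  have [t0|t0] := ltP 0 t; first by rewrite gE// lee_fin; case: ifP => // _; exact: powR_ge0.
  by rewrite /g /cut_fun cF.
have nd t : {homo g ^~ t : n m / (n <= m)%N >-> (n <= m)%E}.
  move=> n m nm; have [t0|t0] := ltP 0 t; last first.
    by rewrite /g /cut_fun !cF.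
  rewrite !gE// lee_fin; case: ifP => [/andP[h1 h2]|_].
    by rewrite h2 (le_trans (cutoff_le w0 nm) h1).
  by case: ifP => // _; exact: powR_ge0.
have lim t : (rpow t (s - 1) * (t < w)%R%:R)%:E = limn (g ^~ t).
  apply/esym/cvg_lim => //; apply: cvg_near_cst.
  have [t0|t0] := ltP 0 t; last first.
    apply: nearW => n; rewrite /g /cut_fun cF//=.
    by rewrite /rpow ltNge t0 mul0r.
  apply: filterS (near_cutoff w t0) => n h; rewrite gE// h /= /rpow t0.
  by case: ltP => _; rewrite ?mulr1 ?mulr0.
under eq_integral do rewrite lim.
have cv := @cvg_monotone_convergence _ _ _ mu setT measurableT g mg
  (fun n x _ => g0 n x) (fun x _ => nd x).
move/cvg_lim : (cv) => <- //.
apply: lime_le; first by apply: cvgP cv.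
apply: nearW => n; rewrite /g /cut_fun integral_itv_if integral_Re_cpow; first last.
- by rewrite -[0]/((0 : R)%:C) (inj_eq (@complexI R)) gt_eqF.
- by rewrite cutoff_gt0//= cutoff_lt.
have cn0 := cutoff_gt0 n w0.
rewrite !cpowR// -rmorphB mul1r -fmorphV -rmorphM lee_fin /= /rpow w0.
by rewrite ler_pM2r ?invr_gt0// gerBl powR_ge0.
Qed.

Lemma measurable_rpow_cut s w : measurable_fun setT (fun t => rpow t (s - 1) * (t < w)%R%:R).
Proof.
apply: measurable_funM; first exact: measurable_rpow.
rewrite (_ : (fun _ => _) = (fun t => if t < w then 1 else 0)).
  by apply: measurable_fun_ifT => //; exact: measurable_fun_ltr.
by apply/funext => t; case: ifP.
Qed.

Lemma integrable_rpow_cut s w : 0 < s ->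
  mu.-integrable setT (EFin \o (fun t => rpow t (s - 1) * (t < w)%R%:R)).
Proof.
move=> s0; apply/integrableP; split.
  by apply/measurable_EFinP; exact: measurable_rpow_cut.
under eq_integral do rewrite /= ger0_norm ?mulr_ge0 ?rpow_ge0//.
exact: le_lt_trans (rpow_cut_integral_le w s0) (ltry _).
Qed.

(** For q >= |p| positive, ln (k t / q) < k t / q gives t^q <= (q / k)^q e^(k t). *)
Lemma powR_le_expR p k : 0 < k -> exists2 C, 0 <= C &
  forall t, 1 <= t -> t `^ p <= C * expR (k * t).
Proof.
move=> k0; pose q := `|p| + 1.
have q0 : 0 < q by rewrite ltr_wpDl.
exists (expR (- (q * ln (k / q)))); first exact: expR_ge0.
move=> t t1; have t0 : 0 < t by rewrite (lt_le_trans _ t1).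
apply: le_trans (_ : t `^ q <= _).
  by rewrite ler_powR// (le_trans (ler_norm _))// lerDl.
rewrite /powR gt_eqF// -expRD ler_expR.
have h : ln (k / q * t) < k / q * t by rewrite ln_sublinear// mulr_gt0 ?divr_gt0.
rewrite lnM ?posrE ?divr_gt0// in h.
have := ltr_pM2l q0 (ln (k / q) + ln t) (k / q * t).
rewrite h => /ltW; rewrite (_ : q * (k / q * t) = k * t); last by field; rewrite gt_eqF.
lra.
Qed.

Lemma measurable_expRN k : measurable_fun setT (fun t : R => expR (- (k * t))).
Proof.
apply: (measurableT_comp (@measurable_expR R)).
by apply: measurableT_comp => //; apply: measurable_funM.
Qed.

(** Below 1 the power alone is integrable; above 1 half of the exponential
    absorbs it. *)
Lemma integrable_rpow_exp s k : 0 < s -> 0 < k ->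
  mu.-integrable setT (EFin \o (fun t => rpow t (s - 1) * expR (- (k * t)))).
Proof.
move=> s0 k0; have k2 : 0 < k / 2 by rewrite divr_gt0.
have [C C0 hC] := powR_le_expR (s - 1) k2.
have i1 := integrable_rpow_cut 1 s0.
have i2 := integrableZl measurableT (C / (k / 2)) (integrable_exponential_pdf k2).
apply: (le_integrable _ _ _ (integrableD measurableT i1 i2)) => //.
  apply/measurable_EFinP; apply: measurable_funM; [exact: measurable_rpow|exact: measurable_expRN].
move=> t _ /=; rewrite lee_fin ger0_norm ?mulr_ge0 ?rpow_ge0 ?expR_ge0//.
apply: le_trans (ler_norm _).
have pd0 := exponential_pdf_ge0 (ltW k2) t.
rewrite /rpow; case: ifPn => t0; last by rewrite !mul0r add0r mulr_ge0// divr_ge0// ltW.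
have [t1|t1] := ltP t 1.
  rewrite mulr1 -[leLHS]addr0 lerD ?mulr_ge0 ?invr_ge0 ?(ltW k2)//.
  by rewrite ler_piMr ?powR_ge0// expR_le1 oppr_le0 mulr_ge0// ltW.
rewrite mulr0 add0r exponential_pdfE ?(ltW t0)//.
rewrite mulrA divfK ?gt_eqF//.
apply: le_trans (ler_wpM2r (expR_ge0 _) (hC t t1)) _.
by rewrite -(mulrA C) -expRD ler_wpM2l// ler_expR; lra.
Qed.

End gamma_integrals.

(** * The integral of a complex power over a bounded interval *)

Section power_integral.
Variable R : realType.
Local Notation mu := (@lebesgue_measure R).
Implicit Types (a z c y : R[i]) (t u w p k s e r : R).

Lemma Re_gt0_neq0 a : 0 < Re a -> a != 0.
Proof. by apply: contraTneq => ->; rewrite ltxx. Qed.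

(** The same exhaustion as in the real case, with dominated convergence. *)
Lemma cint_ppow_cut a w : 0 < Re a ->
  cint mu (fun t => ppow t (a - 1) * ((t < w)%R%:R)%:C) = ppow w a / a.
Proof.
move=> a0; have an0 := Re_gt0_neq0 a0.
have [w0|w0] := ltP 0 w; last first.
  rewrite (ppow_le0 _ w0) mul0r -[RHS](@cint0 _ _ _ mu); apply: eq_cint => t.
  have [t0|t0] := ltP 0 t; last by rewrite ppow_le0// mul0r.
  by rewrite ltNge (le_trans w0 (ltW t0)) mulr0.
pose F n t := if cutoff w n <= t < w then cpow t (a - 1) else 0.
have FE n : cint mu (F n) = (cpow w a - cpow (cutoff w n) a) / a.
  have c01 : 0 < cutoff w n < w by rewrite cutoff_gt0// cutoff_lt.
  apply: complex_eq.
    rewrite /cint /= /Rintegral.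
    rewrite (_ : (fun x => (Re (F n x))%:E) = (fun t =>
      (if cutoff w n <= t < w then Re (1 * cpow t (a - 1)) else 0)%:E)); last first.
      by apply/funext => t; rewrite /F mul1r; case: ifP.
    by rewrite integral_itv_if integral_Re_cpow// mul1r.
  (* The imaginary part of z is the real part of - i z. *)
  rewrite /cint /= /Rintegral.
  rewrite (_ : (fun x => (Im (F n x))%:E) = (fun t =>
    (if cutoff w n <= t < w then Re (- 'i * cpow t (a - 1)) else 0)%:E)); last first.
    by apply/funext => t; rewrite /F mulNr ReN mulrC ReiNIm opprK; case: ifP.
  rewrite integral_itv_if integral_Re_cpow//.
  by rewrite -mulrA mulNr ReN mulrC ReiNIm opprK.
have h1 : ccvg (fun n => cint mu (F n)) (cint mu (fun t => ppow t (a - 1) * ((t < w)%R%:R)%:C)).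
  apply: (@cint_dominated_cvg _ _ _ mu F _ (fun t => rpow t (Re a - 1) * (t < w)%R%:R)).
  - move=> n; have [mr mi] := measurable_cpow (a - 1).
    have mI : measurable_fun [set: R] (fun t : R => cutoff w n <= t < w).
      by apply: measurable_and => //; exact: measurable_fun_ler || exact: measurable_fun_ltr.
    split; [under eq_fun do rewrite (fun_if (@Re R))|under eq_fun do rewrite (fun_if (@Im R))];
      by apply: measurable_fun_ifT.
  - move=> t; apply: cvg_near_cst.
    have [t0|t0] := ltP 0 t; last first.
      apply: nearW => n; rewrite ppow_le0// mul0r subr0 /F.
      by rewrite leNgt (le_lt_trans t0 (cutoff_gt0 n w0)) ComplexField.Normc.normc0.
    apply: filterS (near_cutoff w t0) => n h; rewrite /F h /= ppowE//.
    by case: ltP => _; rewrite ?mulr1 ?mulr0 subrr ComplexField.Normc.normc0.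
  - exact: integrable_rpow_cut.
  - move=> n t; rewrite /F; case: ifPn => [/andP[ct tw]|_]; last first.
      by rewrite ComplexField.Normc.normc0 mulr_ge0// rpow_ge0.
    have t0 := lt_le_trans (cutoff_gt0 n w0) ct.
    by rewrite normc_cpow// tw mulr1 /rpow t0 ReD ReN.
apply: (ccvg_unique h1); rewrite (ppowE _ w0) /ccvg.
have -> : (fun n => normc (cint mu (F n) - cpow w a / a)) =
    (fun n => cutoff w n `^ Re a * normc a^-1).
  apply/funext => n; rewrite FE -mulrBl normcM addrAC subrr sub0r.
  by rewrite normc_opp normc_cpow// cutoff_gt0.
rewrite -(mul0r (normc a^-1)); apply: cvgM; [exact: cutoff_powR|exact: cvg_cst].
Qed.

End power_integral.

(** * Euler's kernel on a wedge *)

Section wedge_integral.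
Variable R : realType.
Local Notation mu := (@lebesgue_measure R).
Local Notation RR := (measurableTypeR R * measurableTypeR R)%type.
Implicit Types (a z c y : R[i]) (t u w p k s e r : R).

Lemma measurable_expN : measurable_fun setT (fun t : R => expR (- t)).
Proof. exact: (measurableT_comp (@measurable_expR R)). Qed.

Lemma measurable_indic (b : RR -> bool) : measurable_fun setT b ->
  measurable_fun setT (fun q => (b q)%:R : R).
Proof.
move=> mb; rewrite (_ : (fun _ => _) = (fun q => if b q then 1 else 0)).
  by apply: measurable_fun_ifT.
by apply/funext => q; case: (b q).
Qed.

(** The integrand t^(a-1) w^z e^(-w) on the wedge 0 < t < w of the (t, w) plane. *)
Definition wedge a z (q : RR) : R[i] :=
  ppow q.1 (a - 1) * ((q.1 < q.2)%R%:R)%:C * (ppow q.2 z * (expR (- q.2))%:C).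

Lemma measurable_wedge a z : cmeasurable (wedge a z).
Proof.
apply: cmeasurableM.
  apply: cmeasurableM.
    exact: (cmeasurable_comp (measurable_ppow (a - 1)) measurable_fst).
  by apply: cmeasurableR; apply: measurable_indic; apply: measurable_fun_ltr.
apply: cmeasurableM.
  exact: (cmeasurable_comp (measurable_ppow z) measurable_snd).
by apply: cmeasurableR; apply: (measurableT_comp measurable_expN).
Qed.

Lemma normc_wedge a z q : normc (wedge a z q) =
  rpow q.1 (Re a - 1) * (q.1 < q.2)%R%:R * (rpow q.2 (Re z) * expR (- q.2)).
Proof.
rewrite /wedge !normcM !normc_ppow !normcR ger0_norm// ger0_norm ?expR_ge0//.
by rewrite ReD ReN.
Qed.

Lemma integrable_wedge a z : 0 < Re a -> 0 < Re (a + z + 1) ->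
  cintegrable (mu \x mu)%E (wedge a z).
Proof.
move=> a0 az0.
pose H (q : RR) :=
  rpow q.1 (Re a - 1) * (q.1 < q.2)%R%:R * (rpow q.2 (Re z) * expR (- q.2)).
have mn : measurable_fun [set: RR] H.
  apply: measurable_funM.
    apply: measurable_funM; first exact: (measurableT_comp (measurable_rpow _) measurable_fst).
    by apply: measurable_indic; apply: measurable_fun_ltr.
  apply: measurable_funM; first exact: (measurableT_comp (measurable_rpow _) measurable_snd).
  exact: (measurableT_comp measurable_expN).
apply: cintegrable_dominated; first exact: measurable_wedge; last first.
  by move=> q; rewrite normc_wedge; exact: (lexx (H q)).
apply/(integrable21ltyP mu mu); first exact/measurable_EFinP.
have i1 := integrable_rpow_exp az0 ltr01.
have [_] := integrableP _ _ _ (integrableZl measurableT (Re a)^-1 i1).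
apply: le_lt_trans; apply: ge0_le_integral => //.
- by move=> w _; apply: integral_ge0.
- apply: (measurable_fun_fubini_tonelli_G (abse \o (EFin \o H))).
    by apply: measurableT_comp => //; exact/measurable_EFinP.
  by move=> q; exact: abse_ge0.
- apply: measurableT_comp => //; apply: measurable_funeM.
  exact: measurable_int i1.
move=> w _ /=.
set K := rpow w (Re z) * expR (- w).
have K0 : 0 <= K by rewrite mulr_ge0 ?rpow_ge0 ?expR_ge0.
rewrite (_ : (\int[mu]_t _)%E = (\int[mu]_t (K%:E * (rpow t (Re a - 1) * (t < w)%R%:R)%:E))%E).
  rewrite ge0_integralZl//; last 2 first.
  - by apply/measurable_EFinP; exact: measurable_rpow_cut.
  - by move=> t _; rewrite lee_fin mulr_ge0// rpow_ge0.
  apply: le_trans (lee_wpmul2l _ (rpow_cut_integral_le w a0)) _; rewrite ?lee_fin//.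
  apply: le_trans (ler_norm _).
  rewrite !ReD addrK mul1r rpowD /K le_eqVlt; apply/orP; left; apply/eqP; ring.
congr integral; apply/funext => t.
rewrite ger0_norm; first by rewrite -EFinM mulrC.
by rewrite !mulr_ge0// rpow_ge0.
Qed.

Lemma cintegrable_gamma z : 0 < Re z ->
  cintegrable mu (fun t => ppow t (z - 1) * (expR (- t))%:C).
Proof.
move=> z0; apply: (cintegrable_dominated _ (integrable_rpow_exp z0 ltr01)).
  apply: cmeasurableM; first exact: measurable_ppow.
  by apply: cmeasurableR; exact: measurable_expN.
move=> t; rewrite normcM normc_ppow normcR ger0_norm ?expR_ge0// ReD ReN mul1r.
exact: lexx.
Qed.

Lemma cintegrable_ppow_cut a w : 0 < Re a ->
  cintegrable mu (fun t => ppow t (a - 1) * ((t < w)%R%:R)%:C).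
Proof.
move=> a0; apply: (cintegrable_dominated _ (integrable_rpow_cut w a0)).
  apply: cmeasurableM; first exact: measurable_ppow.
  apply: cmeasurableR; rewrite (_ : (fun _ => _) = (fun t => if t < w then 1 else 0)).
    by apply: measurable_fun_ifT => //; exact: measurable_fun_ltr.
  by apply/funext => t; case: ifP.
move=> t; rewrite normcM normc_ppow normcR ger0_norm// ReD ReN.
exact: lexx.
Qed.

(** Integrating over t first leaves w^(a+z) e^(-w) / a, which is Euler's kernel. *)
Lemma cint_wedge a z : 0 < Re a -> 0 < Re (a + z + 1) ->
  cint (mu \x mu)%E (wedge a z) = cGamma (a + z + 1) / a.
Proof.
move=> a0 az0; rewrite -(cint21_prod (integrable_wedge a0 az0)) cGammaE.
rewrite [RHS]mulrC -cintZ; last exact: cintegrable_gamma.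
apply: eq_cint => w.
rewrite (_ : (fun t => wedge a z (t, w)) = (fun t => (ppow w z * (expR (- w))%:C) *
  (ppow t (a - 1) * ((t < w)%R%:R)%:C))); last first.
  by apply/funext => t; rewrite /wedge mulrC.
rewrite cintZ; last exact: cintegrable_ppow_cut.
rewrite cint_ppow_cut// addrK ppowD.
by set A := ppow w a; set B := ppow w z; ring.
Qed.

(** For fixed t, the translation w = t + u maps the half-line u > 0 to the
    section w > t of the wedge. *)
Lemma cint_wedge_shear a z : 0 < Re a -> 0 < Re (a + z + 1) ->
  cint mu (fun t => cint mu (fun u => ppow t (a - 1) * ((0 < u)%R%:R)%:C *
    (ppow (t + u) z * (expR (- (t + u)))%:C))) = cGamma (a + z + 1) / a.
Proof.
move=> a0 az0; rewrite -cint_wedge// -(cint12_prod (integrable_wedge a0 az0)).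
apply: eq_cint => t; rewrite -(@cint_translation R (fun w => wedge a z (t, w)) t); last first.
  exact: (cmeasurable_comp (measurable_wedge a z) (pair1_measurable t)).
by apply: eq_cint => u; rewrite /wedge /= ltrDl.
Qed.

End wedge_integral.

(** * A series for a product of two Gamma values *)

Section gamma_series.
Variable R : realType.
Local Notation mu := (@lebesgue_measure R).
Local Notation RR := (measurableTypeR R * measurableTypeR R)%type.
Implicit Types (a z c y : R[i]) (t u w p s e r : R).

Lemma powR_le_2expR p w : 0 <= p <= 1 -> 0 < w -> w `^ p <= 2 * expR (2^-1 * w).
Proof.
move=> /andP[p0 p1] w0; apply: (@le_trans _ _ (1 + w)).
  have [w1|w1] := leP w 1.
    apply: (@le_trans _ _ 1); last by rewrite lerDl ltW.
    by rewrite -[leRHS](powRr0 w) ger_powR// w0.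
  apply: (@le_trans _ _ w); last by rewrite lerDr.
  by rewrite -[leRHS](powRr1 (ltW w0)) ler_powR// ltW.
have := expR_ge1Dx (2^-1 * w); lra.
Qed.

(** The wedge integrand in the coordinates (t, u), where w = t + u. *)
Definition shear a z (q : RR) : R[i] :=
  ppow q.1 (a - 1) * ((0 < q.2)%R%:R)%:C *
  (ppow (q.1 + q.2) z * (expR (- (q.1 + q.2)))%:C).

Lemma measurable_shear a z : cmeasurable (shear a z).
Proof.
have mD : measurable_fun [set: RR] (fun q : RR => q.1 + q.2 : measurableTypeR R).
  by apply: measurable_funD; [exact: measurable_fst|exact: measurable_snd].
apply: cmeasurableM.
  apply: cmeasurableM.
    exact: (cmeasurable_comp (measurable_ppow (a - 1)) measurable_fst).
  by apply: cmeasurableR; apply: measurable_indic; apply: measurable_fun_ltr.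
apply: cmeasurableM.
  exact: (cmeasurable_comp (measurable_ppow z) mD).
exact: (cmeasurable_comp (cmeasurableR (@measurable_expN R)) mD).
Qed.

(** A product function, hence integrable by Tonelli's theorem, that dominates all
    partial sums of the binomial expansion; half of each exponential has been
    spent on the powers of t + u. *)
Definition majorant (s b : R) (q : RR) : R :=
  (rpow q.1 (s - 1) * expR (- (2^-1 * q.1))) *
  (2 * (rpow q.2 ((1 - b) - 1) * expR (- (2^-1 * q.2)))).

Lemma majorant_ge0 s b q : 0 <= majorant s b q.
Proof. by rewrite !mulr_ge0// ?rpow_ge0 ?expR_ge0. Qed.

Lemma integrable_majorant s b : 0 < s -> b < 1 ->
  (mu \x mu)%E.-integrable setT (EFin \o majorant s b).
Proof.
move=> s0 b1; have h2 : 0 < 2^-1 :> R by rewrite invr_gt0.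
have b0 : 0 < 1 - b by rewrite subr_gt0.
have i2 := integrableZl measurableT 2 (integrable_rpow_exp b0 h2).
exact: (integrable_prodM (integrable_rpow_exp s0 h2) i2).
Qed.

Section quadrant_estimates.
Variables (t u : R) (t0 : 0 < t) (u0 : 0 < u).
Let r := t / (t + u).

Let tu0 : 0 < t + u. Proof. exact: addr_gt0. Qed.

Lemma ratio01 : 0 <= r < 1.
Proof. by rewrite divr_ge0 ?(ltW t0) ?(ltW tu0)//= ltr_pdivrMr// mul1r ltrDl. Qed.

Lemma ratioC : (1 - r) * (t + u) = u.
Proof. by rewrite mulrBl mul1r divfK ?gt_eqF// addrAC subrr add0r. Qed.

Let r1 : 0 < 1 - r. Proof. by rewrite subr_gt0; case/andP: ratio01. Qed.

(** Since 1 - r = u / (t + u), the left-hand side contains (t + u)^(b - p) with an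
    exponent in [0, 1]; this power is at most 2 e^((t + u)/2). *)
Lemma majorant_bound s b p : - b <= p <= b -> b <= 2^-1 ->
  t `^ (s - 1) * ((t + u) `^ (- p) * expR (- (t + u))) * (1 - r) `^ (- b) <=
  majorant s b (t, u).
Proof.
move=> /andP[bp pb] b2.
have -> : (1 - r) `^ (- b) = u `^ (- b) * (t + u) `^ b.
  have -> : u `^ (- b) = ((1 - r) * (t + u)) `^ (- b) by rewrite ratioC.
  rewrite powRM ?(ltW r1) ?(ltW tu0)// -mulrA -powRD.
    by rewrite addNr powRr0 mulr1.
  by rewrite (gt_eqF tu0) implybT.
have h : (t + u) `^ (b - p) <= 2 * expR (2^-1 * (t + u)).
  by apply: powR_le_2expR => //; lra.
rewrite powRD in h; last by rewrite (gt_eqF tu0) implybT.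
have E : expR (- (t + u)) = expR (- (2^-1 * (t + u))) * (expR (- (2^-1 * t)) * expR (- (2^-1 * u))).
  by rewrite -!expRD; congr expR; lra.
have {}h : (t + u) `^ b * (t + u) `^ (- p) * expR (- (2^-1 * (t + u))) <= 2.
  rewrite -ler_pdivlMr ?expR_gt0// expRN invrK; exact: h.
rewrite /majorant /= /rpow t0 u0 E (_ : 1 - b - 1 = - b); last by ring.
set A := t `^ _; set B := u `^ _; set P := (t + u) `^ _; set Q := (t + u) `^ _.
set X := expR (- (2^-1 * t)); set Y := expR (- (2^-1 * u)).
rewrite [leLHS](_ : _ = (A * X * (B * Y)) * (Q * P * expR (- (2^-1 * (t + u))))); last by ring.
rewrite [leRHS](_ : _ = (A * X * (B * Y)) * 2); last by ring.
by rewrite ler_wpM2l// !mulr_ge0 ?powR_ge0 ?expR_ge0.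
Qed.

Lemma shearE a z n : shear (a + n%:R) (z - n%:R) (t, u) =
  cpow t (a - 1) * (cpow (t + u) z * (expR (- (t + u)))%:C) * (r ^+ n)%:C.
Proof.
rewrite /shear /= u0 mulr1 !ppowE// addrAC !cpowD cpowX//.
have -> : cpow (t + u) (- n%:R) = ((t + u)^-1 ^+ n)%:C.
  have h : (t + u)%:C ^+ n != 0 by rewrite expf_neq0// (inj_eq (@complexI R) _ 0) gt_eqF.
  apply: (mulIf h); rewrite -{1}cpowX// cpowNK -rmorphXn -rmorphM /=.
  by rewrite -exprMn mulVf ?expr1n// gt_eqF.
rewrite exprMn [in RHS]rmorphM /= [in RHS](rmorphXn (real_complex R)).
set A := cpow t a; set B := cpow (t + u) z; set D := cpow t _.
by ring.
Qed.

End quadrant_estimates.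

Lemma shear_out a z (q : RR) : ~~ ((0 < q.1) && (0 < q.2)) -> shear a z q = 0.
Proof.
rewrite negb_and /shear => /orP[h|/negbTE ->]; last by rewrite mulr0 mul0r.
by rewrite ppow_le0 ?mul0r// leNgt.
Qed.

Variables (s y : R[i]) (s0 : 0 < Re s) (y2 : normc y < 2^-1).
Let b := normc y.

Let y1 : b < 1. Proof. by apply: lt_trans y2 _; lra. Qed.

Let Rey : - b <= Re y <= b. Proof. by rewrite -ler_norml normc_Re. Qed.

Definition shear_sum n (q : RR) : R[i] :=
  \sum_(k < n) rising_ratio y k * shear (s + k%:R) (- y - k%:R) q.

Lemma shear_sumE t u n : 0 < t -> 0 < u -> shear_sum n (t, u) =
  cpow t (s - 1) * (cpow (t + u) (- y) * (expR (- (t + u)))%:C) *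
  binomial_sum y n (t / (t + u)).
Proof.
move=> t0 u0; rewrite /shear_sum /binomial_sum mulr_sumr; apply: eq_bigr => k _.
by rewrite shearE// mulrCA.
Qed.

Lemma shear_sum_le n q : normc (shear_sum n q) <= majorant (Re s) b q.
Proof.
have [/andP[t0 u0]|h] := boolP ((0 < q.1) && (0 < q.2)); last first.
  rewrite /shear_sum big1 ?ComplexField.Normc.normc0 ?majorant_ge0// => k _.
  by rewrite shear_out// mulr0.
case: q t0 u0 => t u /= t0 u0; rewrite shear_sumE//.
apply: le_trans (majorant_bound t0 u0 (Re s) Rey (ltW y2)).
have tu0 : 0 < t + u by exact: addr_gt0.
rewrite normcM (normcM (cpow t _)) (normcM (cpow (t + u) _)) !normc_cpow// normcR.
rewrite ger0_norm ?expR_ge0// ReD !ReN ler_wpM2l ?mulr_ge0 ?powR_ge0 ?expR_ge0//.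
exact/normc_binomial_sum/ratio01.
Qed.

Lemma shear_le (k : nat) q : normc (shear (s + k%:R) (- y - k%:R) q) <= majorant (Re s) b q.
Proof.
have [/andP[t0 u0]|h] := boolP ((0 < q.1) && (0 < q.2)); last first.
  by rewrite shear_out// ComplexField.Normc.normc0 majorant_ge0.
case: q t0 u0 => t u /= t0 u0; rewrite shearE//.
apply: le_trans (majorant_bound t0 u0 (Re s) Rey (ltW y2)).
have tu0 : 0 < t + u by exact: addr_gt0.
have r01 := ratio01 t0 u0; have /andP[r0 r1] := r01.
rewrite normcM (normcM (cpow t _)) (normcM (cpow (t + u) _)) !normc_cpow// !normcR.
rewrite [ `|expR _|]ger0_norm ?expR_ge0// [ `|_ ^+ _|]ger0_norm ?exprn_ge0//.
rewrite ReD !ReN ler_wpM2l ?mulr_ge0 ?powR_ge0 ?expR_ge0//.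
apply: le_trans (binomial_sum_le 1 (normc_ge0 y) r01).
by rewrite big_ord1 rising_ratio0 expr0 mulr1 exprn_ile1// ltW.
Qed.

(** Dominated convergence for the partial sums of the binomial expansion of
    u^(-y) in powers of t / (t + u), inside the double integral of
    t^(s-1) u^(-y) e^(-t-u). *)
Lemma gamma_series_cvg :
  ccvg (fun n => \sum_(k < n) rising_ratio y k * (cGamma (s + 1 - y) / (s + k%:R)))
    (cGamma s * cGamma (1 - y)).
Proof.
have Im := integrable_majorant s0 y1.
have y0 : 0 < Re (1 - y) by rewrite ReD ReN /= subr_gt0 (le_lt_trans (proj2 (andP Rey))).
pose g (q : RR) : R[i] := (ppow q.1 (s - 1) * (expR (- q.1))%:C) *
  (ppow q.2 ((1 - y) - 1) * (expR (- q.2))%:C).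
have ig : cintegrable (mu \x mu)%E g.
  have [/cintegrable_meas m1 /cintegrable_meas m2] :=
    (cintegrable_gamma s0, cintegrable_gamma y0).
  apply: (cintegrable_dominated _ (integrable_prodM
    (integrable_rpow_exp s0 ltr01) (integrable_rpow_exp y0 ltr01))).
    apply: cmeasurableM; [exact: (cmeasurable_comp m1 measurable_fst)|
                          exact: (cmeasurable_comp m2 measurable_snd)].
  move=> [t u]; rewrite /g /= !normcM !normc_ppow !normcR !ger0_norm ?expR_ge0//.
  by rewrite !ReD !ReN !mul1r.
have -> : cGamma s * cGamma (1 - y) = cint (mu \x mu)%E g.
  rewrite -(cint12_prod ig) [in cGamma s]cGammaE mulrC -cintZ; last exact: cintegrable_gamma.
  apply: eq_cint => t; rewrite /g /= cintZ; last exact: cintegrable_gamma.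
  by rewrite -cGammaE mulrC.
have -> : (fun n => \sum_(k < n) rising_ratio y k * (cGamma (s + 1 - y) / (s + k%:R))) =
    (fun n => cint (mu \x mu)%E (shear_sum n)).
  apply/funext => n; rewrite /shear_sum (@cint_sum _ _ _ _ n (fun k q =>
    rising_ratio y k * shear (s + k%:R) (- y - k%:R) q)); last first.
    move=> k; apply: cintegrableZ; apply: (cintegrable_dominated _ Im); last exact: shear_le.
    exact: measurable_shear.
  apply: eq_bigr => k _.
  have ik : cintegrable (mu \x mu)%E (shear (s + k%:R) (- y - k%:R)).
    by apply: (cintegrable_dominated _ Im); [exact: measurable_shear|exact: shear_le].
  rewrite cintZ// -(cint12_prod ik) cint_wedge_shear.
  - by congr (_ * (cGamma _ / _)); ring.
  - by rewrite ReD -(rmorph_nat (real_complex R)) /= ltr_wpDr.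
  - rewrite (_ : _ + _ + 1 = s + (1 - y)); last by ring.
    by rewrite ReD addr_gt0.
apply: (@cint_dominated_cvg _ _ _ _ _ _ (majorant (Re s) b)) => //.
- move=> n; apply: (@cmeasurable_sum _ _ _ n (fun k q =>
    rising_ratio y k * shear (s + k%:R) (- y - k%:R) q)) => k.
  apply: cmeasurableM; first exact: cmeasurable_cst.
  exact: measurable_shear.
- move=> q; have [/andP[t0 u0]|h] := boolP ((0 < q.1) && (0 < q.2)); last first.
    apply: cvg_near_cst; apply: nearW => n.
    rewrite /shear_sum big1; last by move=> k _; rewrite shear_out// mulr0.
    rewrite sub0r normc_opp /g; move: h; rewrite negb_and -!leNgt => /orP[h|h].
      by rewrite (ppow_le0 _ h) !mul0r ComplexField.Normc.normc0.
    by rewrite (ppow_le0 _ h) mul0r mulr0 ComplexField.Normc.normc0.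
  case: q t0 u0 => t u /= t0 u0.
  have r01 := ratio01 t0 u0; have /andP[r0 r1] := r01.
  have tu0 : 0 < t + u by exact: addr_gt0.
  have r10 : 0 < 1 - t / (t + u) by rewrite subr_gt0.
  have -> : g (t, u) = cpow t (s - 1) * (cpow (t + u) (- y) * (expR (- (t + u)))%:C) *
      cpow (1 - t / (t + u)) (- y).
    rewrite /g /= !ppowE// (_ : 1 - y - 1 = - y); last by ring.
    have -> : cpow u (- y) = cpow ((1 - t / (t + u)) * (t + u)) (- y) by rewrite ratioC.
    rewrite cpowM// opprD expRD rmorphM /=.
    by set A := cpow t _; set B := cpow _ _; set D := cpow (t + u) _; ring.
  rewrite (_ : (fun n => shear_sum n (t, u)) = (fun n =>
    cpow t (s - 1) * (cpow (t + u) (- y) * (expR (- (t + u)))%:C) *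
    binomial_sum y n (t / (t + u)))).
    by apply: ccvgZ; exact: binomial_series.
  by apply/funext => n; exact: shear_sumE.
- by move=> n q; exact: shear_sum_le.
Qed.

End gamma_series.

(** * The functional equation of Gamma and the absence of zeros *)

Section gamma_functional.
Variable R : realType.
Local Notation mu := (@lebesgue_measure R).
Implicit Types (a z c y s : R[i]) (t u w p e r v : R).

Lemma cGamma1 : cGamma (1 : R[i]) = 1.
Proof.
have E (t : R) : cpow t (1 - 1 : R[i]) * cexp (- t%:C) = (expR (- t))%:C.
  by rewrite subrr cpow0 mul1r -(rmorphN (real_complex R) t) cexpR.
rewrite /cGamma; apply: complex_eq.
  rewrite [LHS](_ : _ = \int[mu]_(t in `]0, +oo[) expR (- t)); last first.
    by congr (Rintegral _ _); apply/funext => t; rewrite E.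
  rewrite [RHS](_ : _ = fine 1)// -(@integral_exponential_pdf R 1 ltr01) /Rintegral; congr fine.
  rewrite integral_itv_obnd_cbnd; last first.
    apply/measurable_EFinP; apply: measurable_funTS; exact: measurable_expN.
  rewrite integral_mkcond; congr integral; apply/funext => t.
  rewrite /exponential_pdf !patchE; case: ifP => // _.
  by rewrite mulN1r mul1r.
rewrite [LHS](_ : _ = \int[mu]_(t in `]0, +oo[) 0); last first.
  by congr (Rintegral _ _); apply/funext => t; rewrite E.
by rewrite /Rintegral integral0.
Qed.

Lemma rising_ratio_0S k : rising_ratio (0 : R[i]) k.+1 = 0.
Proof. by rewrite /rising_ratio big_ord_recl /= addr0 mul0r mul0r. Qed.

(** The case y = 0 of the series, which then has a single nonzero term. *)
Lemma cGammaS z : 0 < Re z -> cGamma (z + 1) = z * cGamma z.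
Proof.
move=> z0; have zn0 := Re_gt0_neq0 z0.
have y2 : normc (0 : R[i]) < 2^-1 by rewrite ComplexField.Normc.normc0 invr_gt0.
have := gamma_series_cvg z0 y2; rewrite !subr0 cGamma1 mulr1 => h.
have {h} -> := ccvg_unique h (_ : ccvg _ (cGamma (z + 1) / z)).
  by rewrite mulrC divfK.
apply: cvg_near_cst; exists 1%N => // n /= n0.
rewrite -(prednK n0) big_ord_recl rising_ratio0 mul1r addr0 big1 ?addr0.
  by rewrite subrr ComplexField.Normc.normc0.
by move=> k _; rewrite /bump /= rising_ratio_0S mul0r.
Qed.

Lemma Re_cint_le (f g : R -> R[i]) : cintegrable mu f -> cintegrable mu g ->
  (forall t, Re (f t) <= Re (g t)) -> Re (cint mu f) <= Re (cint mu g).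
Proof. by move=> [fr _] [gr _] h; apply: le_Rintegral => // t _; exact: h. Qed.

(** On ]0, 1[ the kernel is at least t^(p-1) / e, with integral 1 / (p e). *)
Lemma Re_cGamma_gt0 p : 0 < p -> 0 < Re (cGamma p%:C).
Proof.
move=> p0.
have p0' : 0 < Re (p%:C) by [].
have ic := cintegrable_ppow_cut 1 p0'.
have h : Re (cint mu (fun t => (expR (- 1))%:C * (ppow t (p%:C - 1) * ((t < 1)%R%:R)%:C))) <=
    Re (cGamma p%:C).
  rewrite cGammaE; apply: Re_cint_le.
  - exact: cintegrableZ.
  - exact: cintegrable_gamma.
  move=> t; rewrite mulrC -[1]/((1 : R)%:C) -rmorphB ppowR !ReMr /=.
  rewrite -mulrA ler_wpM2l ?rpow_ge0//.
  case: ltP => t1; last by rewrite mul0r expR_ge0.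
  by rewrite mul1r ler_expR lerN2 ltW.
apply: lt_le_trans h; rewrite cintZ// cint_ppow_cut// mulrC ReMr.
rewrite ppowR /rpow ltr01 powR1 -fmorphV -rmorphM /=.
by rewrite mul1r mulr_gt0 ?invr_gt0// expR_gt0.
Qed.

Lemma cos_ge r : 1 - r ^+ 2 / 2 <= cos r.
Proof.
have sin_le (x : R) : `|sin x| <= `|x|.
  wlog x0 : x / 0 <= x.
    move=> h; have [/h//|x0] := leP 0 x.
    by rewrite -normrN -sinN -[leRHS]normrN h// oppr_ge0 ltW.
  have [s _] := @MVT_segment R sin cos 0 x x0 (fun t _ => is_derive_sin t)
    (continuous_subspaceT (@continuous_sin R)).
  rewrite sin0 !subr0 => ->; rewrite normrM ler_piMl//.
  exact: cos_max.
rewrite (_ : cos r = 1 - 2 * sin (r / 2) ^+ 2).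
  have : sin (r / 2) ^+ 2 <= (r / 2) ^+ 2.
    by rewrite -[leLHS]real_normK ?num_real// -[leRHS]real_normK ?num_real// lerXn2r ?nnegrE.
  by rewrite expr_div_n; lra.
rewrite {1}(_ : r = (r / 2) *+ 2); last by rewrite -mulr_natr divfK.
by rewrite cos_mulr2n sin2cos2; lra.
Qed.

(** With v = x^2 this reads |ln x| <= |x - 1/x|, which follows from
    1 - 1/x <= ln x <= x - 1. *)
Lemma ln_sqr_le v : 0 < v -> ln v ^+ 2 <= 4 * (v - 2 + v^-1).
Proof.
move=> v0; pose x := Num.sqrt v.
have x0 : 0 < x by rewrite sqrtr_gt0.
have vE : v = x ^+ 2 by rewrite sqr_sqrtr// ltW.
rewrite vE lnXn// (_ : (ln x *+ 2) ^+ 2 = 4 * ln x ^+ 2); last by ring.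
rewrite (_ : x ^+ 2 - 2 + (x ^+ 2)^-1 = (x - x^-1) ^+ 2); last by field; rewrite gt_eqF.
rewrite ler_pM2l//.
have ub w : 0 < w -> ln w <= w - 1.
  by move=> w0; rewrite -{1}(subrKC 1 w) le_ln1Dx// ltrBrDl subrr.
have h1 := ub x x0.
have xi0 : 0 < x^-1 by rewrite invr_gt0.
have h2 := ub _ xi0; rewrite lnV ?posrE// in h2.
have xx : x * x^-1 = 1 by rewrite divff// gt_eqF.
have [x1|x1] := leP 1 x.
  have l0 : 0 <= ln x by exact: ln_ge0.
  have xi1 : x^-1 <= 1 by rewrite invf_le1.
  by rewrite lerXn2r ?nnegrE//; lra.
have l0 : ln x <= 0 by rewrite ln_le0// ltW.
have xi1 : 1 <= x^-1 by rewrite invf_ge1// ltW.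
rewrite -sqrrN -[leRHS]sqrrN lerXn2r ?nnegrE//; lra.
Qed.

(** Write z = p + iq and let v = t / p.  The real part of p^(-iq) t^(z-1) e^(-t) is
    t^(p-1) e^(-t) cos (q ln v), at least t^(p-1) e^(-t) (1 - 2 q^2 (v - 2 + 1/v)).  The
    latter is a combination of the kernels of Gamma at p, p + 1 and p - 1, so by
    the functional equation its integral is (p - 1 - 2 q^2) Gamma(p - 1) > 0. *)
Lemma cGamma_neq0_large z : 1 + 2 * Im z ^+ 2 < Re z -> cGamma z != 0.
Proof.
set p := Re z; set q := Im z => hp.
have p1 : 1 < p by apply: le_lt_trans hp; rewrite lerDl mulr_ge0// sqr_ge0.
have p0 : 0 < p by apply: lt_trans p1.
have pm0 : 0 < p - 1 by rewrite subr_gt0.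
apply/eqP => z0.
pose A s (t : R) : R[i] := ppow t (s - 1) * (expR (- t))%:C.
have iA s : 0 < Re s -> cintegrable mu (A s) by exact: cintegrable_gamma.
(* c is p^(-iq), which removes the phase at t = p; c1, c2 and c3 are the
   coefficients of the kernels at p, p + 1 and p - 1 in the lower bound. *)
pose c := cexp (0 -i* (q * ln p)).
pose c1 : R[i] := (1 + 4 * q ^+ 2)%:C.
pose c2 : R[i] := (- (2 * q ^+ 2 / p))%:C.
pose c3 : R[i] := (- (2 * q ^+ 2 * p))%:C.
have i1 := cintegrableZ c1 (iA p%:C p0).
have i2 := cintegrableZ c2 (iA (p + 1)%:C (addr_gt0 p0 ltr01)).
have i3 := cintegrableZ c3 (iA (p - 1)%:C pm0).
have iz := cintegrableZ c (iA z p0).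
have gA s : cint mu (A s) = cGamma s by rewrite cGammaE.
have pC x : (x + 1)%:C = x%:C + 1 :> R[i] by rewrite rmorphD.
have g1 : cGamma p%:C = (p - 1)%:C * cGamma (p - 1)%:C.
  by rewrite -cGammaS// -pC subrK.
have g2 : cGamma (p + 1)%:C = p%:C * ((p - 1)%:C * cGamma (p - 1)%:C).
  by rewrite pC cGammaS// g1.
have := Re_cint_le (cintegrableD i1 (cintegrableD i2 i3)) iz.
rewrite (cintD i1 (cintegrableD i2 i3)) (cintD i2 i3).
rewrite (cintZ c1 (iA p%:C p0)) (cintZ c2 (iA (p + 1)%:C (addr_gt0 p0 ltr01))).
rewrite (cintZ c3 (iA (p - 1)%:C pm0)) (cintZ c (iA z p0)) !gA z0 mulr0.
rewrite g2 g1; have := Re_cGamma_gt0 pm0; set X := cGamma _ => X0 h.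
suff : Re (c1 * ((p - 1)%:C * X) + (c2 * (p%:C * ((p - 1)%:C * X)) + c3 * X)) <= 0.
  pose K : R := (1 + 4 * q ^+ 2) * (p - 1) - (2 * q ^+ 2 / p) * (p * (p - 1)) - 2 * q ^+ 2 * p.
  rewrite (_ : _ + _ = X * K%:C); last by rewrite /c1 /c2 /c3 /K; ring.
  rewrite ReMr (_ : K = p - (1 + 2 * q ^+ 2)); last by rewrite /K; field; rewrite gt_eqF.
  by rewrite pmulr_rle0// subr_le0 leNgt hp.
apply: h => t; rewrite /A.
have [t0|t0] := ltP 0 t; last by rewrite !ppow_le0// !mul0r !mulr0 !addr0.
have tn0 : t != 0 by rewrite gt_eqF.
have pn0 : p != 0 by rewrite gt_eqF.
(* All kernels are multiples of t^(p-2) e^(-t). *)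
pose P := t `^ (p - 2); have P0 : 0 <= P by exact: powR_ge0.
have c0 : cpow t (p%:C - 1) = (P * t)%:C.
  rewrite (_ : p%:C - 1 = (p - 2 + 1)%:C); last by ring.
  by rewrite cpowR// powRD ?(negbTE tn0) ?implybT// powRr1// ltW.
have c2' : cpow t ((p + 1)%:C - 1) = (P * t * t)%:C.
  rewrite (_ : (p + 1)%:C - 1 = (p%:C - 1) + 1); last by ring.
  by rewrite cpowD c0 cpow_id// -rmorphM.
have c3' : cpow t ((p - 1)%:C - 1) = P%:C.
  by rewrite (_ : (p - 1)%:C - 1 = (p - 2)%:C) ?cpowR//; ring.
have cz : cpow t (z - 1) = (P * t)%:C * cpow t (0 +i* q).
  rewrite -c0 -cpowD; congr cpow; rewrite [in LHS](_ : z = p%:C + (0 +i* q)); first by ring.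
  by apply: complex_eq; rewrite (ReD, ImD) /= ?addr0 ?add0r.
have ecos : Re (c * cpow t (0 +i* q)) = cos (q * ln (t / p)).
  rewrite /c /cpow -cexpD /cexp ReM ReD ImD ReMr ImMr /= mul0r addr0 expR0.
  by rewrite mul1r mul0r subr0 ln_div// mulrBr addrC.
rewrite !ppowE// c0 c2' c3' cz.
rewrite (_ : c * _ = c * cpow t (0 +i* q) * (P * t * expR (- t))%:C); last first.
  by set Y := cpow t _; ring.
rewrite ReMr ecos /c1 /c2 /c3.
rewrite (_ : _ + _ =
  ((1 - 2 * q ^+ 2 * (t / p - 2 + (t / p)^-1)) * (P * t * expR (- t)))%:C); last first.
  rewrite invf_div; have : p%:C != 0 by rewrite (inj_eq (@complexI R) _ 0).
  have : t%:C != 0 by rewrite (inj_eq (@complexI R) _ 0).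
  by move=> ? ?; field; apply/andP.
rewrite /= ler_wpM2r ?mulr_ge0 ?(ltW t0) ?expR_ge0//.
apply: le_trans (cos_ge _).
have := ln_sqr_le (divr_gt0 t0 p0).
rewrite exprMn; have := sqr_ge0 q; set Q := q ^+ 2; set L := ln _ ^+ 2; set V := _ + _ => Q0 LV.
have := ler_wpM2l Q0 LV; lra.
Qed.

(** The functional equation carries a zero to all its translates by positive
    integers, where the real part eventually dominates the imaginary part. *)
Lemma cGamma_neq0 z : 0 < Re z -> cGamma z != 0.
Proof.
move=> z0; apply/eqP => h.
have hn n : cGamma (z + n%:R) = 0 /\ 0 < Re (z + n%:R).
  elim: n => [|n [IH1 IH2]]; first by rewrite addr0.
  rewrite -natr1 addrA cGammaS// IH1 mulr0; split=> //.
  by rewrite ReD addr_gt0.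
have ReIm n : Re (z + n%:R) = Re z + n%:R /\ Im (z + n%:R) = Im z.
  by rewrite -(rmorph_nat (real_complex R)) ReD ImD /= addr0.
pose n := Num.bound (1 + 2 * Im z ^+ 2).
have [hz _] := hn n; have [rE iE] := ReIm n.
have /eqP : cGamma (z + n%:R) != 0 => //.
apply: cGamma_neq0_large; rewrite rE iE.
apply: (@lt_le_trans _ _ n%:R); last by rewrite lerDr ltW.
by rewrite /n archi_boundP// addr_ge0// mulr_ge0// sqr_ge0.
Qed.

End gamma_functional.

(** * Differences of Gamma quotients *)

Section gamma_difference.
Variable R : realType.
Implicit Types (a z c x y s : R[i]).

Lemma rising_ratio_shift (F : fieldType) (y : F) k :
  (forall n : nat, n.+1%:R != 0 :> F) ->
  y * rising_ratio (1 + y) k = (y + k%:R) * rising_ratio y k.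
Proof.
move=> h; elim: k => [|k IH]; first by rewrite !rising_ratio0 addr0.
rewrite !rising_ratioS mulrA IH -natr1; have := h k; rewrite -natr1 => hk.
by field.
Qed.

Definition gamma_quotient s y := cGamma s * cGamma (1 - y) / cGamma (s - y).

(** Termwise (s - y) a_k / (k + s) = a_k - (k + y) a_k / (k + s), and
    (k + y) a_k = y (1 + y)_k / k!. *)
Lemma gamma_quotient_series s y : 0 < Re s -> 0 < Re (s - y) -> normc y < 2^-1 ->
  ccvg (fun n => \sum_(k < n) (rising_ratio y k - y * rising_ratio (1 + y) k / (s + k%:R)))
    (gamma_quotient s y).
Proof.
move=> s0 sy0 y2; have := ccvgZ (cGamma (s - y))^-1 (gamma_series_cvg s0 y2).
rewrite mulrC => h.
rewrite (_ : (fun n => _) = (fun n => (cGamma (s - y))^-1 *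
  (\sum_(k < n) rising_ratio y k * (cGamma (s + 1 - y) / (s + k%:R))))) //.
apply/funext => n; rewrite mulr_sumr; apply: eq_bigr => k _.
have -> : s + 1 - y = s - y + 1 by ring.
rewrite cGammaS//.
have g0 := cGamma_neq0 sy0.
have sk : s + k%:R != 0.
  by apply: Re_gt0_neq0; rewrite -(rmorph_nat (real_complex R)) ReD /= ltr_wpDr.
rewrite rising_ratio_shift; last by move=> m; rewrite pnatr_eq0.
by field; rewrite sk g0.
Qed.

(** The sum over m and n of the terms of the double series with n_1 = N + 1. *)
Definition gamma_term x y (N : nat) : R[i] :=
  x * y * rising_ratio (1 + y) N / ((N%:R + 2^-1) * (N%:R + 2^-1 - x)).

Lemma halfE : 2^-1 = (2^-1 : R)%:C.
Proof. by rewrite fmorphV rmorph_nat. Qed.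

Lemma Re_half_sub z : normc z < 2^-1 -> 0 < Re (2^-1 - z).
Proof.
move=> hz; rewrite ReD ReN halfE /= subr_gt0; apply: le_lt_trans hz.
exact: le_trans (ler_norm _) (normc_Re _).
Qed.

(** In the difference of the two series of gamma_quotient_series the terms a_k,
    which do not depend on s, cancel. *)
Lemma gamma_difference_series x y :
  normc x < 2^-1 -> normc y < 2^-1 -> normc (x + y) < 2^-1 ->
  ccvg (fun n => \sum_(N < n) gamma_term x y N)
    (gamma_quotient 2^-1 y - gamma_quotient (2^-1 - x) y).
Proof.
move=> x2 y2 xy2.
have h0 : 0 < Re (2^-1 : R[i]) by rewrite halfE /= invr_gt0.
have hx := Re_half_sub x2; have hy := Re_half_sub y2.
have hxy : 0 < Re (2^-1 - x - y) by rewrite -addrA -opprD; exact: Re_half_sub.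
have := ccvgB (gamma_quotient_series h0 hy y2) (gamma_quotient_series hx hxy y2).
rewrite (_ : (fun n => _ - _) = (fun n => \sum_(N < n) gamma_term x y N))//.
apply/funext => n; rewrite -sumrB; apply: eq_bigr => k _; rewrite /gamma_term.
have p0 z : 0 < Re z -> k%:R + z != 0.
  by move=> z0; apply: Re_gt0_neq0; rewrite -(rmorph_nat (real_complex R)) ReD /= ltr_wpDl.
have n1 := p0 _ h0; have n2 := p0 _ hx.
rewrite addrA in n2; have -> : 2^-1 - x + k%:R = k%:R + 2^-1 - x by ring.
rewrite [2^-1 + _]addrC; set H := k%:R + 2^-1 in n1 n2 *.
by field; rewrite n1 n2.
Qed.

(** The sum telescopes: with d_N = (1 + b)_N / (N! (N + 1)), its N-th term is
    (d_N - d_(N+1)) / (1 - b). *)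
Lemma rising_ratio_sum_le (b : R) n : 0 <= b < 1 ->
  \sum_(N < n) rising_ratio (1 + b) N / (N.+1%:R * N.+2%:R) <= (1 - b)^-1.
Proof.
move=> /andP[b0 b1]; have b1' : 0 < 1 - b by rewrite subr_gt0.
have E : \sum_(N < n) rising_ratio (1 + b) N / (N.+1%:R * N.+2%:R) =
    (1 - b)^-1 * (1 - rising_ratio (1 + b) n / n.+1%:R).
  elim: n => [|n IH]; first by rewrite big_ord0 rising_ratio0 divr1 subrr mulr0.
  rewrite big_ord_recr IH /= rising_ratioS.
  rewrite -[n.+2%:R]natr1 -[n.+1%:R]natr1.
  have n0 : (0 : R) <= n%:R by [].
  by field; rewrite !gt_eqF//; lra.
rewrite E ler_piMr ?invr_ge0 ?(ltW b1')// gerBl divr_ge0// rising_ratio_ge0//.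
by rewrite addr_ge0.
Qed.

End gamma_difference.

(** * The R-values as simple series *)

Section Rvalue_series.
Variable R : realType.
Implicit Types (N n m j : nat) (s t : seq nat).

(** The elementary symmetric function of degree n in 1, 1/2, ..., 1/N, by recursion
    on the largest index j + 1 that occurs. *)
Fixpoint harmonic_sum n N : R :=
  if n is n'.+1 then \sum_(j < N) harmonic_sum n' j / j.+1%:R else 1.

Lemma harmonic_sum_ge0 n N : 0 <= harmonic_sum n N.
Proof.
elim: n N => [|n IH] N //=.
by apply: sumr_ge0 => j _; rewrite divr_ge0.
Qed.

(** The decreasing sequences n_2 > ... > n_r > 0 that can follow n_1 = N + 1, with
    n = r - 1.  Appending 0 to the sequence expresses that its entries are positive. *)
Definition chains_below N n : set (seq nat) :=
  [set t | size t = n /\ path gtn N.+1 (rcons t 0%N)].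

(** A decreasing sequence is determined by its head and by its tail. *)
Lemma esum_chain_head (I : set nat) n (a : seq nat -> \bar R) :
  (forall s, 0 <= a s)%E ->
  (\esum_(s in [set s | exists2 j, I j & exists2 t, chains_below j n t & s = j.+1 :: t]) a s =
   \esum_(j in I) \esum_(t in chains_below j n) a (j.+1 :: t))%E.
Proof.
move=> a0; rewrite esum_esum; last by [].
pose f (p : nat * seq nat) := p.1.+1 :: p.2.
have -> : [set s | exists2 j, I j & exists2 t, chains_below j n t & s = j.+1 :: t] =
    f @` (I `*`` (fun j => chains_below j n)).
  apply/seteqP; split => s /=.
    by move=> [j Ij [t ct ->]]; exists (j, t).
  by move=> [[j t] [/= Ij ct] <-]; exists j => //; exists t.
rewrite esum_image//.
by move=> [j t] [j' t'] _ _ [-> ->].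
Qed.

Lemma chains_below0 N : chains_below N 0 = [set [::]].
Proof.
by apply/seteqP; split => t /=; [case=> /size0nil -> | move=> ->].
Qed.

Lemma chains_belowS N n : chains_below N n.+1 =
  [set s | exists2 j, `I_N j & exists2 t, chains_below j n t & s = j.+1 :: t].
Proof.
apply/seteqP; split => s /=.
  case: s => [|k t]; first by case.
  case=> /= -[st] /andP[kN p]; case: k kN p => [|j] jN p; first by case: t p {st}.
  by exists j => //; exists t.
by move=> [j jN [t [st p] ->]]; rewrite /chains_below /= st; split=> //; rewrite p andbT.
Qed.

Lemma Rvalue_indexS n : Rvalue_index n.+1 =
  [set s | exists2 j, setT j & exists2 t, chains_below j n t & s = j.+1 :: t].
Proof.
apply/seteqP; split => s /=.
  case: s => [|k t]; first by case.
  case=> /= -[st] p; case: k p => [|j] p; first by case: t p {st}.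
  by exists j => //; exists t.
by move=> [j jN [t [st p] ->]]; rewrite /Rvalue_index /= st.
Qed.

(** The constant c is carried along because the induction moves the factor of
    the head of the sequence out of the product. *)
Lemma esum_chains_below (c : R) N n : 0 <= c ->
  (\esum_(t in chains_below N n) (c / \prod_(i <- t) (2 * i%:R))%:E =
   (c * (harmonic_sum n N / 2 ^+ n))%:E)%E.
Proof.
elim: n N c => [|n IH] N c c0.
  by rewrite chains_below0 esum_set1 big_nil divr1 ?lee_fin//= expr0 divr1 mulr1.
rewrite chains_belowS esum_chain_head; last first.
  by move=> s; rewrite lee_fin divr_ge0// prodr_ge0// => i _; rewrite mulr_ge0.
rewrite (eq_esum (b := fun j => (c / (2 * j.+1%:R) * (harmonic_sum n j / 2 ^+ n))%:E)).
  rewrite esum_fset// -?fsbig_ord.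
    rewrite sumEFin; congr EFin; rewrite /= mulr_suml mulr_sumr; apply: eq_bigr => j _.
    rewrite exprS; field.
    by rewrite nat1r pnatr_eq0 expf_neq0// pnatr_eq0.
  by move=> j _; rewrite lee_fin mulr_ge0// divr_ge0// ?mulr_ge0// ?harmonic_sum_ge0// exprn_ge0.
move=> j _; rewrite -IH ?divr_ge0 ?mulr_ge0//; apply: eq_esum => t _.
by rewrite big_cons invfM mulrA.
Qed.

Lemma Rvalue_term_ones m n N t : size t = n ->
  Rvalue_term R (m.+2 :: nseq n 1%N) (N.+1 :: t) =
  ((2 * N.+1%:R - 1) ^+ m.+2)^-1 / \prod_(i <- t) (2 * i%:R).
Proof.
move=> st; rewrite /Rvalue_term /= size_nseq invfM; congr (_ / _).
rewrite big_add1 /= [RHS](big_nth 0%N) st; apply: eq_big_nat => i /andP[_ i_n].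
by rewrite nth_nseq i_n expr1.
Qed.

(** The contribution of n_1 = N + 1 to R(m + 2, 1, ..., 1) with n ones: the powers of
    2 cancel the factors 2 of the denominators, and 2 n_1 - 1 = 2 (N + 1/2). *)
Definition Rvalue_summand m n N : R := (N%:R + 2^-1) ^- m.+2 * harmonic_sum n N.

Lemma Rvalue_summand_ge0 m n N : 0 <= Rvalue_summand m n N.
Proof. by rewrite mulr_ge0 ?harmonic_sum_ge0// invr_ge0 exprn_ge0// addr_ge0. Qed.

Lemma Rvalue_series m n : cvgn (series (Rvalue_summand m n)) ->
  series (Rvalue_summand m n) J @[J --> \oo] --> Rvalue R (m.+2 :: nseq n 1%N).
Proof.
move=> cv; suff <- : limn (series (Rvalue_summand m n)) = Rvalue R (m.+2 :: nseq n 1%N) by [].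
pose a N : R := ((2 * N.+1%:R - 1) ^+ m.+2)^-1 * (harmonic_sum n N / 2 ^+ n).
have base0 N : 0 <= 2 * N.+1%:R - 1 :> R.
  by rewrite -[N.+1%:R]natr1; have : (0 : R) <= N%:R by []; lra.
have a0 N : 0 <= a N.
  by rewrite mulr_ge0 ?invr_ge0 ?exprn_ge0// divr_ge0 ?harmonic_sum_ge0 ?exprn_ge0.
have aE N : a N = (2 ^+ (m.+2 + n))^-1 * Rvalue_summand m n N.
  rewrite /a /Rvalue_summand exprD -[N.+1%:R]natr1.
  rewrite (_ : 2 * (N%:R + 1) - 1 = 2 * (N%:R + 2^-1) :> R); last by field.
  rewrite exprMn; field.
  by rewrite !expf_neq0 ?pnatr_eq0// gt_eqF// ltr_wpDl.
have E : (\esum_(s in Rvalue_index n.+1) (Rvalue_term R (m.+2 :: nseq n 1%N) s)%:E =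
    \sum_(N <oo) (a N)%:E)%E.
  have tE N t : chains_below N n t -> Rvalue_term R (m.+2 :: nseq n 1%N) (N.+1 :: t) =
      ((2 * N.+1%:R - 1) ^+ m.+2)^-1 / \prod_(i <- t) (2 * i%:R).
    by case=> st _; exact: Rvalue_term_ones.
  have t0 N t : chains_below N n t ->
      0 <= Rvalue_term R (m.+2 :: nseq n 1%N) (N.+1 :: t).
    move=> /tE ->; apply: divr_ge0; first by rewrite invr_ge0 exprn_ge0.
    by apply: prodr_ge0 => i _; apply: mulr_ge0.
  (* The absolute value makes the summand nonnegative on all sequences; the
     term itself may be negative when the first index is 0. *)
  rewrite (eq_esum (b := fun s => `|Rvalue_term R (m.+2 :: nseq n 1%N) s|%:E)); last first.
    by move=> s; rewrite Rvalue_indexS => -[j _ [t ct ->]]; rewrite ger0_norm// t0.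
  rewrite Rvalue_indexS esum_chain_head; last by move=> s; rewrite lee_fin.
  rewrite nneseries_esumT; last by move=> N; rewrite lee_fin.
  apply: eq_esum => N _; rewrite -esum_chains_below ?invr_ge0 ?exprn_ge0//.
  by apply: eq_esum => t ct; rewrite ger0_norm ?t0// tE.
rewrite /Rvalue /= size_nseq E.
have sE : series a = (fun J => 2 ^- (m.+2 + n) * series (Rvalue_summand m n) J).
  by apply/funext => J; rewrite /series /= mulr_sumr; apply: eq_bigr => N _.
have cva : cvgn (series a).
  by rewrite sE; apply: is_cvgM; [exact: is_cvg_cst|].
have -> : (\sum_(N <oo) (a N)%:E)%E = (limn (series a))%:E.
  rewrite -EFin_lim//; congr (limn _); apply/funext => J.
  by rewrite /series /= sumEFin.
rewrite /= sE limM//; last exact: is_cvg_cst.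
by rewrite lim_cst// sumn_nseq mul1n mulrA divff ?mul1r// expf_neq0//.
Qed.

End Rvalue_series.

(** * Generating function and unconditional sums *)

Section generating_function.
Variable R : realType.
Implicit Types (x y : R[i]) (N M m n : nat).

(** Induction on N: allowing the index N + 1 multiplies the generating function by
    1 + y / (N + 1). *)
Lemma harmonic_gen y N M : (N <= M)%N ->
  \sum_(n < M.+1) (harmonic_sum R n N)%:C * y ^+ n = rising_ratio (1 + y) N.
Proof.
elim: N M => [|N IH] M NM.
  rewrite rising_ratio0 big_ord_recl /= expr0 mulr1 big1 ?addr0// => n _.
  by rewrite /bump /= big_ord0 mul0r.
case: M NM => // M NM; rewrite rising_ratioS big_ord_recl /=.
have -> : \sum_(i < M.+1) (harmonic_sum R (bump 0 i) N.+1)%:C * y ^+ bump 0 i =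
   \sum_(i < M.+1) (harmonic_sum R (bump 0 i) N)%:C * y ^+ bump 0 i +
   y / N.+1%:R * rising_ratio (1 + y) N.
  rewrite -(IH M NM) mulr_sumr -big_split /=; apply: eq_bigr => n _.
  rewrite /bump /= add1n /= big_ord_recr /= rmorphD mulrDl; congr (_ + _).
  by rewrite rmorphM fmorphV rmorph_nat exprS; ring.
have := IH M.+1 (leqW NM); rewrite big_ord_recl /= => H.
rewrite addrA H -[N.+1%:R]natr1; field.
by rewrite natr1 pnatr_eq0.
Qed.

End generating_function.

Section unconditional.
Variables (I : choiceType) (R : realType).

Lemma ccvg_sum (r : seq I) (u : nat -> I -> R[i]) (l : I -> R[i]) :
  (forall i, ccvg (u ^~ i) (l i)) ->
  ccvg (fun n => \sum_(i <- r) u n i) (\sum_(i <- r) l i).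
Proof.
move=> h; have h0 : \sum_(i <- r) normc (u n i - l i) @[n --> \oo] --> (0 : R).
  elim: r => [|i r IH]; first by under eq_fun do rewrite big_nil; exact: cvg_cst.
  under eq_fun do rewrite big_cons.
  have := cvgD (h i) IH; rewrite addr0; exact.
apply: (squeeze_cvgr _ (cvg_cst 0) h0); apply: nearW => n.
by rewrite normc_ge0 -sumrB normc_sum.
Qed.

Lemma ccvg_dist_le (u : nat -> R[i]) (l a : R[i]) (e : R) : ccvg u l ->
  (\forall n \near \oo, normc (u n - a) <= e) -> normc (l - a) <= e.
Proof.
move=> ul ua; apply/ler_addgt0Pr => z z0.
move/cvgrPdist_lt : ul => /(_ _ z0) ul.
have [n [h1 h2]] := @filter_ex _ \oo _ _ (filterI ul ua).
rewrite (_ : l - a = (u n - a) - (u n - l)); last by ring.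
apply: le_trans (normcB _ _) _; rewrite lerD//.
by move: h1; rewrite sub0r normrN ger0_norm ?normc_ge0// => /ltW.
Qed.

Lemma sum_fsubset (V : zmodType) (f : I -> V) (A B : {fset I}) : (A `<=` B)%fset ->
  \sum_(i <- B) f i = \sum_(i <- A) f i + \sum_(i <- B | i \notin A) f i.
Proof.
move=> AB; rewrite (bigID (mem A)) /=; congr (_ + _).
rewrite -big_filter; apply: perm_big; apply: uniq_perm; rewrite ?filter_uniq//.
move=> i; rewrite mem_filter; case: (boolP (i \in A)) => //= iA.
by move/fsubsetP : AB => ->.
Qed.

Lemma ler_sum_fsubset (f : I -> R) (A B : {fset I}) : (forall i, 0 <= f i) ->
  (A `<=` B)%fset -> \sum_(i <- A) f i <= \sum_(i <- B) f i.
Proof. by move=> f0 AB; rewrite (sum_fsubset f AB) lerDl sumr_ge0. Qed.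

(** Convergence of a family to its sum along the directed set of finite subsets. *)
Definition uncond_cvg (f : I -> R[i]) (l : R[i]) := forall e : R, 0 < e ->
  exists A : {fset I}, forall B : {fset I}, (A `<=` B)%fset ->
    normc (\sum_(i <- B) f i - l) <= e.

(** If the sums of absolute values over E n approach their upper bound d, then
    what lies outside E n is small in absolute value, so the sums over all finite
    sets containing E n are close to each other. *)
Lemma uncond_cvg_exhaust (f : I -> R[i]) (l : R[i]) (d : R) (E : nat -> {fset I}) :
  (forall A : {fset I}, \sum_(i <- A) normc (f i) <= d) ->
  (\sum_(i <- E n) normc (f i) @[n --> \oo] --> d) ->
  ccvg (fun n => \sum_(i <- E n) f i) l -> uncond_cvg f l.
Proof.
move=> fd Ed El e e0; have e2 : 0 < e / 2 by rewrite divr_gt0.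
move/cvgrPdist_lt : Ed => /(_ _ e2) Ed.
move/cvgrPdist_lt : El => /(_ _ e2) El.
have [n [h1 h2]] := @filter_ex _ \oo _ _ (filterI Ed El).
exists (E n) => B EB; rewrite (sum_fsubset f EB) addrAC.
apply: le_trans (normcD _ _) _; rewrite [e]splitr lerD//.
  by move: h2; rewrite sub0r normrN ger0_norm ?normc_ge0// => /ltW.
apply: le_trans (normc_sum _ _ _) _.
have := fd B; rewrite (sum_fsubset (fun i => normc (f i)) EB) => h3.
move: h1; rewrite ltr_norml => /andP[_ h1]; lra.
Qed.

(** An exchange of a series with an unconditional sum: the summable bound d makes
    the tail of the series over N small uniformly in the finite index set, and
    the remaining finitely many N are handled one at a time. *)
Lemma uncond_cvg_series (f : nat -> I -> R[i]) (F : I -> R[i]) (s : nat -> R[i])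
    (d : nat -> R) (l : R[i]) :
  (forall i, ccvg (fun n => \sum_(N < n) f N i) (F i)) ->
  (forall N (A : {fset I}), \sum_(i <- A) normc (f N i) <= d N) ->
  cvgn (series d) ->
  (forall N, uncond_cvg (f N) (s N)) ->
  ccvg (fun n => \sum_(N < n) s N) l ->
  uncond_cvg F l.
Proof.
move=> fF fd cd fs sl e e0; have e3 : 0 < e / 3 by rewrite divr_gt0.
have d0 N : 0 <= d N by have := fd N fset0%fset; rewrite big_seq_fset0.
move/cvgrPdist_lt : (cd) => /(_ _ e3) hd.
move/cvgrPdist_lt : sl => /(_ _ e3) hs.
have [K [h1 h2]] := @filter_ex _ \oo _ _ (filterI hd hs).
have [A hA] : exists A : {fset I}, forall B : {fset I}, (A `<=` B)%fset ->
    normc (\sum_(N < K) \sum_(i <- B) f N i - \sum_(N < K) s N) <= e / 3.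
  (* The denominator is K + 1 and not K because K may be 0. *)
  have : forall n, exists A : {fset I}, forall B : {fset I}, (A `<=` B)%fset ->
      normc (\sum_(N < n) \sum_(i <- B) f N i - \sum_(N < n) s N) <= n%:R * (e / 3 / K.+1%:R).
    elim=> [|n [A hA]].
      exists fset0%fset => B _.
      by rewrite !big_ord0 subrr mul0r ComplexField.Normc.normc0.
    have eK : 0 < e / 3 / K.+1%:R by rewrite divr_gt0.
    have [A' hA'] := fs n _ eK.
    exists (A `|` A')%fset => B; rewrite fsubUset => /andP[/hA b1 /hA' b2].
    rewrite !big_ord_recr /= opprD addrACA -natr1 mulrDl mul1r.
    exact: le_trans (normcD _ _) (lerD b1 b2).
  move=> /(_ K) [A hA]; exists A => B /hA /le_trans; apply.
  by rewrite mulrCA ler_piMr ?(ltW e3)// ler_pdivrMr// mul1r ler_nat.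
exists A => B /hA hB.
have tail n : (K <= n)%N ->
    normc (\sum_(N < n) \sum_(i <- B) f N i - \sum_(N < K) \sum_(i <- B) f N i) <= e / 3.
  move=> Kn; rewrite -!(big_mkord xpredT (fun N => \sum_(i <- B) f N i)).
  rewrite (big_cat_nat (leq0n K) Kn) //= addrAC subrr add0r.
  apply: le_trans (normc_sum _ _ _) _.
  apply: (@le_trans _ _ (\sum_(K <= N < n) d N)).
    by apply: ler_sum => N _; apply: le_trans (normc_sum _ _ _) (fd N B).
  have : series d n <= limn (series d).
    apply: nondecreasing_cvgn_le => //; apply/nondecreasing_seqP => k.
    by rewrite seriesSr lerDl.
  move: h1; rewrite ltr_norml => /andP[_]; rewrite /series /=.
  rewrite [in X in _ -> X -> _](big_cat_nat (leq0n K) Kn) //=; lra.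
have h4 : normc (\sum_(i <- B) F i - \sum_(N < K) \sum_(i <- B) f N i) <= e / 3.
  apply: (ccvg_dist_le (u := fun n => \sum_(i <- B) \sum_(N < n) f N i)).
    exact: ccvg_sum.
  by exists K => // n Kn; rewrite exchange_big; exact: tail.
have h5 : normc (\sum_(N < K) s N - l) <= e / 3.
  by move: h2; rewrite sub0r normrN ger0_norm ?normc_ge0// => /ltW.
rewrite (_ : _ - l = (\sum_(i <- B) F i - \sum_(N < K) \sum_(i <- B) f N i) +
  ((\sum_(N < K) \sum_(i <- B) f N i - \sum_(N < K) s N) + (\sum_(N < K) s N - l))); last by ring.
have := normcD (\sum_(i <- B) F i - \sum_(N < K) \sum_(i <- B) f N i)
  ((\sum_(N < K) \sum_(i <- B) f N i - \sum_(N < K) s N) + (\sum_(N < K) s N - l)).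
have := normcD (\sum_(N < K) \sum_(i <- B) f N i - \sum_(N < K) s N) (\sum_(N < K) s N - l).
lra.
Qed.

End unconditional.

(** * The double series *)

Section double_series.
Variable R : realType.
Implicit Types (x y : R[i]) (N M m n : nat).

Definition square M : {fset nat * nat} :=
  [fset p in [seq (i, j) | i <- iota 0 M, j <- iota 0 M]]%fset.

Lemma mem_square M p : (p \in square M) = (p.1 < M)%N && (p.2 < M)%N.
Proof.
rewrite inE /=; apply/idP/idP => [/allpairsP[[i j] /= [hi hj ->]]|/andP[h1 h2]] /=.
  by move: hi hj; rewrite !mem_iota /= add0n => -> ->.
apply/allpairsP; exists p; rewrite !mem_iota /= !add0n; split=> //.
by case: (p).
Qed.

Lemma sum_square (V : zmodType) M (f : nat * nat -> V) :
  \sum_(p <- square M) f p = \sum_(m < M) \sum_(n < M) f (nat_of_ord m, nat_of_ord n).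
Proof.
rewrite (perm_big [seq (i, j) | i <- iota 0 M, j <- iota 0 M]) /=; last first.
  apply: uniq_perm; [exact: fset_uniq| |by move=> p; rewrite inE].
  by apply: allpairs_uniq; rewrite ?iota_uniq// => -[? ?] [? ?] _ _ [-> ->].
rewrite big_allpairs -{1}[M]subn0 -/(index_iota 0 M) big_mkord.
by apply: eq_bigr => m _; rewrite -{1}[M]subn0 -/(index_iota 0 M) big_mkord.
Qed.

Lemma fset_sub_square (A : {fset nat * nat}) :
  \forall M \near \oo, (A `<=` square M)%fset.
Proof.
exists (\max_(p <- A) maxn p.1 p.2).+1 => // M /= hM; apply/fsubsetP => p pA.
have := @leq_bigmax_seq _ (enum_fset A) xpredT (fun p => maxn p.1 p.2) p pA isT.
by rewrite mem_square geq_max => /andP[h1 h2]; rewrite !(leq_ltn_trans _ hM).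
Qed.

(** The part of the term of index p of the double series that comes from n_1 = N + 1. *)
Definition level_term x y N (p : nat * nat) : R[i] :=
  (Rvalue_summand R p.1 p.2 N)%:C * x ^+ p.1.+1 * y ^+ p.2.+1.

Lemma normc_level_term x y N p :
  (normc (level_term x y N p))%:C = level_term (normc x)%:C (normc y)%:C N p.
Proof.
rewrite /level_term !normcM !normcX normcR ger0_norm ?Rvalue_summand_ge0//.
by rewrite !rmorphM !rmorphXn.
Qed.

Lemma level_height_neq0 N x : normc x < 2^-1 -> N%:R + 2^-1 - x != 0.
Proof.
move=> x2; apply: Re_gt0_neq0; rewrite -addrA ReD ltr_wpDl ?Re_half_sub//.
by rewrite -(rmorph_nat (real_complex R)).
Qed.

Lemma level_geometric x N M : normc x < 2^-1 ->
  \sum_(m < M) ((N%:R + 2^-1) ^- m.+2 : R)%:C * x ^+ m.+1 =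
  x / ((N%:R + 2^-1) * (N%:R + 2^-1 - x)) * (1 - (x / (N%:R + 2^-1)) ^+ M).
Proof.
move=> x2; have h2 := level_height_neq0 N x2.
have h1 : (N%:R + 2^-1 : R[i]) != 0.
  have := @level_height_neq0 N 0; rewrite subr0; apply.
  by rewrite ComplexField.Normc.normc0 invr_gt0.
have hE : (N%:R + 2^-1 : R)%:C = N%:R + 2^-1 by rewrite rmorphD rmorph_nat halfE.
elim: M => [|M IH]; first by rewrite big_ord0 expr0 subrr mulr0.
rewrite big_ord_recr /= IH fmorphV rmorphXn /= hE.
set H := N%:R + 2^-1 in h1 h2 *.
have hM : H ^+ M != 0 by rewrite expf_neq0.
rewrite !exprS !expr_div_n; field.
by rewrite hM h1 h2.
Qed.

(** On a square of side M > N the generating function is complete, so only the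
    geometric series in x is truncated. *)
Lemma sum_square_level x y N M : normc x < 2^-1 -> (N < M)%N ->
  \sum_(p <- square M) level_term x y N p =
  gamma_term x y N * (1 - (x / (N%:R + 2^-1)) ^+ M).
Proof.
move=> x2; case: M => // M NM; rewrite sum_square.
rewrite (eq_bigr (fun m : 'I_M.+1 => ((N%:R + 2^-1) ^- m.+2 : R)%:C * x ^+ m.+1 *
    (y * rising_ratio (1 + y) N))); last first.
  move=> m _; rewrite -(@harmonic_gen R y N M NM) !mulr_sumr; apply: eq_bigr => n _.
  by rewrite /level_term /Rvalue_summand /= rmorphM /= (exprS y); ring.
by rewrite -mulr_suml level_geometric// /gamma_term; ring.
Qed.

Lemma square_level_cvg x y N : normc x < 2^-1 ->
  ccvg (fun M => \sum_(p <- square M) level_term x y N p) (gamma_term x y N).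
Proof.
move=> x2; pose q := normc (x / (N%:R + 2^-1)).
have hE : N%:R + 2^-1 = (N%:R + 2^-1 : R)%:C by rewrite rmorphD rmorph_nat halfE.
have q1 : `|q| < 1.
  rewrite ger0_norm ?normc_ge0// /q normcM normcV hE normcR ger0_norm ?addr_ge0//.
  by rewrite ltr_pdivrMr ?ltr_wpDl// mul1r (lt_le_trans x2)// lerDr.
have h : normc (gamma_term x y N) * q ^+ M @[M --> \oo] --> (0 : R).
  rewrite -(mulr0 (normc (gamma_term x y N))).
  by apply: cvgM; [exact: cvg_cst|exact: cvg_expr].
apply: (squeeze_cvgr _ (cvg_cst 0) h); exists N.+1 => // M /= NM.
rewrite normc_ge0 sum_square_level//= mulrBr mulr1 addrAC subrr sub0r normc_opp.
by rewrite normcM normcX.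
Qed.

Lemma gamma_termR (X Y : R) N : gamma_term X%:C Y%:C N =
  (X * Y * rising_ratio (1 + Y) N / ((N%:R + 2^-1) * (N%:R + 2^-1 - X)))%:C.
Proof.
rewrite /gamma_term -[1]/((1 : R)%:C) -rmorphD rising_ratioR halfE.
by rewrite -(rmorph_nat (real_complex R)) -!(rmorphD, rmorphB) -!rmorphM -fmorphV -rmorphM.
Qed.

(** The sum of the absolute values of the level terms: taking absolute values
    amounts to replacing x and y by |x| and |y|. *)
Definition level_bound x y N : R := Re (gamma_term (normc x)%:C (normc y)%:C N).

Lemma normc_half x : normc x < 2^-1 -> normc (normc x)%:C < 2^-1.
Proof. by rewrite normcR ger0_norm ?normc_ge0. Qed.

Lemma square_level_norm_cvg x y N : normc x < 2^-1 ->
  \sum_(p <- square M) normc (level_term x y N p) @[M --> \oo] --> level_bound x y N.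
Proof.
move=> x2; have := ccvg_Re (square_level_cvg (normc y)%:C N (normc_half x2)).
rewrite (_ : (fun M => _) = (fun M => \sum_(p <- square M) normc (level_term x y N p)))//.
apply/funext => M; rewrite Re_sum; apply: eq_bigr => p _.
by rewrite -normc_level_term.
Qed.

Lemma level_norm_le x y N (A : {fset nat * nat}) : normc x < 2^-1 ->
  \sum_(p <- A) normc (level_term x y N p) <= level_bound x y N.
Proof.
move=> x2; have h := @square_level_norm_cvg x y N x2.
rewrite -(cvg_lim _ h)//; apply: limr_ge; first by apply: cvgP h.
apply: filterS (fset_sub_square A) => M AM.
by apply: ler_sum_fsubset => // p; exact: normc_ge0.
Qed.

Lemma level_uncond_cvg x y N : normc x < 2^-1 ->
  uncond_cvg (level_term x y N) (gamma_term x y N).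
Proof.
move=> x2; apply: uncond_cvg_exhaust.
- by move=> A; exact: level_norm_le.
- exact: square_level_norm_cvg.
- exact: square_level_cvg.
Qed.

Lemma height_sqr_le N : ((N%:R + 2^-1) ^+ 2)^-1 <= 8 / (N.+1%:R * N.+2%:R) :> R.
Proof.
have n0 : (0 : R) <= N%:R by [].
have h0 : (0 : R) < N%:R + 2^-1 by lra.
rewrite -[N.+2%:R]natr1 -[N.+1%:R]natr1.
rewrite -[leLHS]div1r ler_pdivrMr ?exprn_gt0// mulrAC ler_pdivlMr; last first.
  by rewrite mulr_gt0//; lra.
by rewrite expr2; nra.
Qed.

Lemma cvg_dominated_ratio (b : R) (u : R^nat) (K : R) : 0 <= b < 1 ->
  (forall N, 0 <= u N <= K * (rising_ratio (1 + b) N / (N.+1%:R * N.+2%:R))) ->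
  cvgn (series u).
Proof.
move=> b01 hu; apply: nondecreasing_is_cvgn.
  by apply/nondecreasing_seqP => n; rewrite seriesSr lerDl; case/andP: (hu n).
have K0 : 0 <= K.
  by have := hu 0%N; rewrite rising_ratio0 => /andP[]; lra.
exists (K * (1 - b)^-1) => _ [n _ <-]; rewrite /series /= big_mkord.
apply: le_trans (ler_wpM2l K0 (rising_ratio_sum_le n b01)).
by rewrite mulr_sumr; apply: ler_sum => N _; case/andP: (hu N).
Qed.

Lemma level_bound_cvg x y : normc x < 2^-1 -> normc y < 2^-1 ->
  cvgn (series (level_bound x y)).
Proof.
move=> x2 y2; set X := normc x; set Y := normc y.
have X0 : 0 <= X by exact: normc_ge0.
have Y0 : 0 <= Y by exact: normc_ge0.
have X1 : 0 < 1 - 2 * X by rewrite /X; lra.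
apply: (@cvg_dominated_ratio Y _ (X * Y * 8 / (1 - 2 * X))).
  by rewrite Y0 (lt_trans y2)//; lra.
move=> N; rewrite /level_bound gamma_termR /= -/X -/Y.
have n0 : (0 : R) <= N%:R by [].
have h0 : (0 : R) < N%:R + 2^-1 by lra.
have hX : (N%:R + 2^-1) * (1 - 2 * X) <= N%:R + 2^-1 - X by nra.
have hX0 : 0 < N%:R + 2^-1 - X by apply: lt_le_trans hX; rewrite mulr_gt0.
have rr0 : 0 <= rising_ratio (1 + Y) N by rewrite rising_ratio_ge0// addr_ge0.
apply/andP; split.
  by rewrite !mulr_ge0// invr_ge0 mulr_ge0// ltW.
have B : ((N%:R + 2^-1) * (N%:R + 2^-1 - X))^-1 <= (1 - 2 * X)^-1 * (8 / (N.+1%:R * N.+2%:R)).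
  apply: (@le_trans _ _ ((1 - 2 * X)^-1 * ((N%:R + 2^-1) ^+ 2)^-1)).
    rewrite -invfM lef_pV2 ?posrE ?mulr_gt0 ?exprn_gt0// expr2.
    by have := ler_wpM2l (ltW h0) hX; rewrite mulrA mulrC.
  by rewrite ler_wpM2l ?height_sqr_le// invr_ge0 ltW.
apply: le_trans (ler_wpM2l _ B) _; first by rewrite !mulr_ge0.
by rewrite le_eqVlt; apply/orP; left; apply/eqP; ring.
Qed.

(** The left-hand side is one of the nonnegative terms of the generating function. *)
Lemma harmonic_sum_le (b : R) n N : 0 <= b ->
  harmonic_sum R n N * b ^+ n <= rising_ratio (1 + b) N.
Proof.
move=> b0; have := @harmonic_gen R b%:C N (n + N) (leq_addl _ _).
rewrite -[1]/((1 : R)%:C) -rmorphD rising_ratioR => /(congr1 (@Re R)).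
rewrite Re_sum [X in _ = X -> _]/= => <-.
have nM : (n < (n + N).+1)%N by rewrite ltnS leq_addr.
rewrite (bigD1 (Ordinal nM)) //= -rmorphXn ReMr /= lerDl sumr_ge0// => i _.
by rewrite -rmorphXn ReMr mulr_ge0 ?harmonic_sum_ge0// exprn_ge0.
Qed.

(** Any b in ]0, 1[ gives harmonic_sum n N <= b^(-n) (1 + b)_N / N!; here b = 1/2. *)
Lemma Rvalue_summand_cvg m n : cvgn (series (Rvalue_summand R m n)).
Proof.
apply: (@cvg_dominated_ratio 2^-1 _ (2 ^+ m * 8 * 2 ^+ n)); first by lra.
move=> N; rewrite Rvalue_summand_ge0 /=.
have n0 : (0 : R) <= N%:R by [].
have h0 : (0 : R) < N%:R + 2^-1 by lra.
have hn := @harmonic_sum_le 2^-1 n N (ltW (_ : 0 < 2^-1)).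
have {hn} : harmonic_sum R n N <= 2 ^+ n * rising_ratio (1 + 2^-1) N.
  by rewrite -ler_pdivrMl ?exprn_gt0// -exprVn mulrC; apply: hn; rewrite invr_gt0.
have hm : (N%:R + 2^-1) ^- m.+2 <= 2 ^+ m * (8 / (N.+1%:R * N.+2%:R)) :> R.
  rewrite -[m.+2]addn2 exprD invfM; apply: ler_pM; rewrite ?invr_ge0 ?exprn_ge0 ?(ltW h0)//.
    rewrite -exprVn lerXn2r ?nnegrE ?invr_ge0 ?(ltW h0)//.
    by rewrite -[leRHS]invrK lef_pV2 ?posrE ?invr_gt0//; lra.
  exact: height_sqr_le.
move=> hh; apply: le_trans (ler_pM _ _ hm hh) _.
- by rewrite invr_ge0 exprn_ge0// ltW.
- exact: harmonic_sum_ge0.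
by rewrite le_eqVlt; apply/orP; left; apply/eqP; ring.
Qed.

Lemma double_series_cvg x y :
  normc x < 2^-1 -> normc y < 2^-1 -> normc (x + y) < 2^-1 ->
  uncond_cvg (fun p : nat * nat =>
     (Rvalue R (p.1.+2 :: nseq p.2 1%N))%:C * x ^+ p.1.+1 * y ^+ p.2.+1)
    (gamma_quotient 2^-1 y - gamma_quotient (2^-1 - x) y).
Proof.
move=> x2 y2 xy2.
apply: (@uncond_cvg_series _ _ (level_term x y) _ (gamma_term x y) (level_bound x y)).
- move=> [m n] /=.
  have h := Rvalue_series (@Rvalue_summand_cvg m n).
  have hC : ccvg (fun J => (series (Rvalue_summand R m n) J)%:C)
      (Rvalue R (m.+2 :: nseq n 1%N))%:C.
    by apply: ccvg_ReIm => //=; exact: cvg_cst.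
  have := ccvgZ (x ^+ m.+1 * y ^+ n.+1) hC; rewrite [_ * (Rvalue _ _)%:C]mulrC !mulrA.
  rewrite (_ : (fun J => _) = (fun J => \sum_(N < J) level_term x y N (m, n)))//.
  apply/funext => J; rewrite /series /= big_mkord rmorph_sum mulr_sumr.
  by apply: eq_bigr => N _; rewrite /level_term /=; ring.
- by move=> N A; exact: level_norm_le.
- exact: level_bound_cvg.
- by move=> N; exact: level_uncond_cvg.
- exact: gamma_difference_series.
Qed.

End double_series.

Theorem theorem4p1 (R : realType) (x y : R[i])
  (hx : `|x| < 2^-1) (hy : `|y| < 2^-1) (hxy : `|x + y| < 2^-1) :
  partial_sum (fun p : nat * nat =>
     (Rvalue R (p.1.+2 :: nseq p.2 1%N))%:C * x ^+ p.1.+1 * y ^+ p.2.+1)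
    @ totally -->
  (cGamma (2^-1) * cGamma (1 - y) / cGamma (2^-1 - y)
   - cGamma (2^-1 - x) * cGamma (1 - y) / cGamma (2^-1 - x - y) : (R[i] : numFieldType)).
Proof.
have toR (z : R[i]) : `|z| < 2^-1 -> normc z < 2^-1 by rewrite halfE ltcR.
have h := double_series_cvg (toR _ hx) (toR _ hy) (toR _ hxy).
have FF : Filter (@totally (nat * nat)%type) := @totally_filter _.
apply/(@cvgrPdist_le _ (R[i] : numFieldType)^o) => -[e e'] /=; rewrite ltcE /= => /andP[/eqP -> e0].
have [A hA] := h _ e0; exists A => // B /= /hA hB.
rewrite big_seq_fsetE /= in hB.
by rewrite distrC lecR; exact: hB.
Qed.
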